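(* Consider the $n\times n$ toroidal grid, with generator set $\mathbf S$ and set of empty rectangles $\mathrm{Rect}^\circ$. There exists a sign assignment $\mathcal S:\mathrm{Rect}^\circ\to\{\pm1\}$. Moreover, the sign assignment is essentially unique: if $\mathcal S_1$ and $\mathcal S_2$ are two sign assignments, then there is a function $f:\mathbf S\to\{\pm1\}$ such that for all $\mathbf x,\mathbf y\in\mathbf S$ and all $r\in\mathrm{Rect}^\circ(\mathbf x,\mathbf y)$, $$\mathcal S_1(r)=f(\mathbf x)\cdot f(\mathbf y)\cdot\mathcal S_2(r).$$
   Context: The $n\times n$ toroidal grid is the oriented torus $\mathcal T=\mathbb R^2/(n\mathbb Z)^2$ with its $n$ horizontal and $n$ vertical circles (images of lines with integer coordinate), cut into $n^2$ unit squares. $\mathbf S$ is the set of $n$-tuples of intersection points of horizontal and vertical circles with exactly one point on each horizontal and each vertical circle. For $\mathbf x,\mathbf y\in\mathbf S$ that agree along all but two horizontal circles, $\mathrm{Rect}(\mathbf x,\mathbf y)$ is the set of embedded rectangles $r$ in $\mathcal T$ with edges on horizontal and vertical circles, all four corners in $\mathbf x\cup\mathbf y$, such that each horizontal edge, oriented as boundary of $r$, goes from a point of $\mathbf x$ to a point of $\mathbf y$ (i.e. lower-left and upper-right corners are in $\mathbf x$, the other two in $\mathbf y$); otherwise $\mathrm{Rect}(\mathbf x,\mathbf y)=\emptyset$. $\mathrm{Rect}^\circ(\mathbf x,\mathbf y)\subset\mathrm{Rect}(\mathbf x,\mathbf y)$ consists of the empty rectangles, those with $\mathrm{Int}(r)\cap\mathbf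 x=\emptyset$; $\mathrm{Rect}^\circ$ is the union over all $\mathbf x,\mathbf y$ (an element of $\mathrm{Rect}^\circ$ remembers its initial and terminal generators). For $r_1\in\mathrm{Rect}^\circ(\mathbf x,\mathbf y)$ and $r_2\in\mathrm{Rect}^\circ(\mathbf y,\mathbf z)$, $r_1*r_2$ denotes the sum of $r_1$ and $r_2$ as 2-chains (in the cell structure by unit squares), regarded as a domain from $\mathbf x$ to $\mathbf z$. A sign assignment is a function $\mathcal S:\mathrm{Rect}^\circ\to\{\pm1\}$ such that: (Sq) for any four distinct $r_1,r_2,r_1',r_2'\in\mathrm{Rect}^\circ$ with $r_1*r_2=r_1'*r_2'$, $\mathcal S(r_1)\mathcal S(r_2)=-\mathcal S(r_1')\mathcal S(r_2')$; (V) if $r_1,r_2\in\mathrm{Rect}^\circ$ are such that $r_1*r_2$ is a vertical annulus, then $\mathcal S(r_1)\mathcal S(r_2)=-1$; (H) if $r_1,r_2\in\mathrm{Rect}^\circ$ are such that $r_1*r_2$ is a horizontal annulus, then $\mathcal S(r_1)\mathcal S(r_2)=+1$. *)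

(* Defs.v *)
From HB Require Import structures.
From mathcomp Require Import all_boot all_order all_algebra all_fingroup.

Set Implicit Arguments.
Unset Strict Implicit.
Unset Printing Implicit Defensive.

Import GRing.Theory.
Local Open Scope ring_scope.

(* The point (i, j) is the intersection of the vertical circle of abscissa i  *)
(* with the horizontal circle of ordinate j.                                  *)
Definition point (n : nat) := ('I_n * 'I_n)%type.

(* A generator is indexed by the horizontal circles: x j is the abscissa of   *)
(* its point on the horizontal circle j; bijectivity of x says that there is  *)
(* exactly one point on each vertical circle.                                 *)
Definition generator (n : nat) := {perm 'I_n}.

Definition points n (x : generator n) : {set point n} :=
  [set (x j, j) | j : 'I_n].

(* The number of unit steps in the positive direction from a to b on the      *)
(* circle R/nZ, in [0, n).                                                    *)
Definition cdist n (a b : 'I_n) : nat := ((b + (n - a)) %% n)%N.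

(* The unit interval [i, i + 1] lies in the positively oriented arc [a, b].   *)
Definition in_arc n (a b i : 'I_n) : bool := (cdist a i < cdist a b)%N.

(* The integer point i lies in the interior of the positively oriented arc    *)
(* from a to b.                                                               *)
Definition in_open_arc n (a b i : 'I_n) : bool :=
  (0 < cdist a i < cdist a b)%N.

(* An embedded rectangle is the product of the positively oriented arcs from  *)
(* (l, b) to (r, t), where (l, b) is its lower-left and (r, t) its upper-     *)
(* right corner; embeddedness amounts to l != r and b != t.                   *)
Record rect (n : nat) := MkRect {
  diag : point n * point n;
  _ : (diag.1.1 != diag.2.1) && (diag.1.2 != diag.2.2) }.

HB.instance Definition _ n := [isSub for @diag n].
HB.instance Definition _ n := [Finite of rect n by <:].

Section Rectangles.
Variable n : nat.
Implicit Types (x y : generator n) (r : rect n).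

Definition left r : 'I_n := (diag r).1.1.
Definition bottom r : 'I_n := (diag r).1.2.
Definition right r : 'I_n := (diag r).2.1.
Definition top r : 'I_n := (diag r).2.2.

Definition agree_but_two x y : bool := #|[set j | x j != y j]| == 2%N.

Definition Rect x y : {set rect n} :=
  [set r | [&& agree_but_two x y,
               (left r, bottom r) \in points x,
               (right r, top r) \in points x,
               (right r, bottom r) \in points y
             & (left r, top r) \in points y]].

Definition interior_points r : {set point n} :=
  [set p | in_open_arc (left r) (right r) p.1
           && in_open_arc (bottom r) (top r) p.2].

Definition Rect0 x y : {set rect n} :=
  [set r in Rect x y | interior_points r :&: points x == set0].

End Rectangles.

(* The disjoint union of the sets Rect0 x y, as triples (x, y, r).            *)
Record empty_rect (n : nat) := MkEmptyRect {
  er_val : generator n * generator n * rect n;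
  _ : er_val.2 \in Rect0 er_val.1.1 er_val.1.2 }.

HB.instance Definition _ n := [isSub for @er_val n].
HB.instance Definition _ n := [Finite of empty_rect n by <:].

Definition EmptyRect n (x y : generator n) (r : rect n)
  (hr : r \in Rect0 x y) : empty_rect n := @MkEmptyRect n (x, y, r) hr.

Definition source n (r : empty_rect n) : generator n := (er_val r).1.1.
Definition target n (r : empty_rect n) : generator n := (er_val r).1.2.
Definition shape n (r : empty_rect n) : rect n := (er_val r).2.

(* Cellular 2-chains; (i, j) indexes the unit square whose lower-left corner  *)
(* is the point (i, j).                                                       *)
Definition chain2 (n : nat) := {ffun 'I_n * 'I_n -> int}.

Definition rect_chain n (r : rect n) : chain2 n :=
  [ffun s => (in_arc (left r) (right r) s.1
              && in_arc (bottom r) (top r) s.2)%:R].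

Record domain (n : nat) := Domain {
  dom_source : generator n;
  dom_target : generator n;
  dom_chain : chain2 n }.

(* Only meaningful when target r1 = source r2.                                *)
Definition star n (r1 r2 : empty_rect n) : domain n :=
  Domain (source r1) (target r2)
         (rect_chain (shape r1) + rect_chain (shape r2)).

Definition composable n (r1 r2 : empty_rect n) : Prop := target r1 = source r2.

(* The annulus between two distinct vertical (resp. horizontal) circles; no   *)
(* width restriction is imposed.                                              *)
Definition vertical_annulus n (D : domain n) : Prop :=
  exists a b : 'I_n, a != b /\ dom_chain D = [ffun s => (in_arc a b s.1)%:R].

Definition horizontal_annulus n (D : domain n) : Prop :=
  exists a b : 'I_n, a != b /\ dom_chain D = [ffun s => (in_arc a b s.2)%:R].

Definition pm1 : {pred int} := pred2 1 (-1).

Record sign_assignment n (S : empty_rect n -> int) : Prop := SignAssignment {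
  sign_pm1 : forall r, S r \in pm1;
  sign_Sq : forall r1 r2 r1' r2' : empty_rect n,
    uniq [:: r1; r2; r1'; r2'] ->
    composable r1 r2 -> composable r1' r2' ->
    star r1 r2 = star r1' r2' ->
    S r1 * S r2 = - (S r1' * S r2');
  sign_V : forall r1 r2 : empty_rect n,
    composable r1 r2 -> vertical_annulus (star r1 r2) -> S r1 * S r2 = -1;
  sign_H : forall r1 r2 : empty_rect n,
    composable r1 r2 -> horizontal_annulus (star r1 r2) -> S r1 * S r2 = 1 }.

(* Main.v *)
Require Import Defs.
From HB Require Import structures.
From mathcomp Require Import all_boot all_order all_algebra all_fingroup.
From mathcomp Require Import zify ring.

(* Existence.  Lift the symmetric group to the spin group inside the Clifford *)
(* algebra on e_1, ..., e_n, sending the transposition (i j) to e_i - e_j up  *)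
(* to scaling, and choose one lift of each generator.  Multiplying the lift   *)
(* of x on the left by e_b - e_t yields the lift of the target of a rectangle *)
(* from row b to row t, up to a sign, which is the sign of that rectangle.    *)
(* Exchanging b and t changes the sign, and (e_b - e_t)^2 > 0: this gives (V) *)
(* and (H).  For two decompositions of a domain, (Sq) says that e_b - e_t     *)
(* and e_c - e_d anticommute when b, t, c, d are distinct; when the two       *)
(* rectangles share a corner, the domain is L-shaped, one decomposition puts  *)
(* them side by side and the other one on top of each other, and (Sq) is the  *)
(* relation                                                                   *)
(*   (e_i - e_j) (e_j - e_k) = (e_j - e_k) (e_k - e_i).                       *)
(*                                                                            *)
(* Uniqueness.  Let phi be the product of two sign assignments.  On           *)
(* rectangles of height one between the rows a and a + 1, phi satisfies the   *)
(* relations of the Coxeter presentation of the symmetric group, hence is a   *)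
(* coboundary there.  Cutting L-shaped domains in two ways propagates this,   *)
(* by induction on the height, to the rectangles not crossing the circle of   *)
(* ordinate 0, then, through the vertical annuli, to all rectangles of width  *)
(* one, and finally, by induction on the width, to all rectangles.            *)

(** The existence half rests on [word_act_vacuum]: a word of transpositions with trivial product
    acts on the vacuum by a scalar. Two chosen lifts can thus be compared, and [spin_signM] reduces
    a product of two signs to the sign of one word, where the Clifford relations apply. The
    combinatorial half of (Sq) is [spin_sign_square]. A composite induces the identity (annuli), a
    product of two disjoint transpositions (disjoint rows) or a 3-cycle (L shapes), so these types
    never mix. An L shape has at most one side-by-side and one stacked decomposition
    ([side_by_side_inj], [stacked_inj]), and the two have opposite signs ([side_by_side_stacked]).
    For uniqueness, [coboundary] provides a potential f on rectangles of height one. The correction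
    of phi by f, called [gauge], is then shown to be 1 everywhere by means of [gauge_L], in the
    steps [gauge_rising], [gauge_narrow] and [gauge_all]. *)

Set Implicit Arguments.
Unset Strict Implicit.
Unset Printing Implicit Defensive.

Import Order.TTheory GRing.Theory Num.Theory.
Local Open Scope ring_scope.

(** * Spin lifts of permutations *)

Section Clifford.
Variable n : nat.
Implicit Types (A B : {set 'I_n}) (P Q : pred 'I_n) (i j k : 'I_n).

Definition toggle k A : {set 'I_n} := [set a | (a \in A) (+) (a == k)].

Lemma toggleK k : involutive (toggle k).
Proof. by move=> A; apply/setP=> a; rewrite !inE addbK. Qed.

Lemma toggleC j k A : toggle j (toggle k A) = toggle k (toggle j A).
Proof. by apply/setP=> a; rewrite !inE addbAC. Qed.

Definition sgn P A : int := \prod_(a in A) (-1) ^+ P a.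

Lemma sgn_toggle P k A : sgn P (toggle k A) = (-1) ^+ P k * sgn P A.
Proof.
rewrite /sgn big_mkcond (bigD1 k) //= [X in _ = _ * X]big_mkcond.
rewrite [X in _ = _ * X](bigD1 k) //= inE eqxx addbT mulrA; congr (_ * _).
  by case: (k \in A); rewrite ?mulr1 // -expr2 sqrr_sign.
by apply: eq_bigr => a /negPf ak; rewrite inE ak addbF.
Qed.

Lemma sgn_sqr P A : sgn P A * sgn P A = 1.
Proof.
by rewrite /sgn -big_split big1 //= => a _; rewrite -expr2 sqrr_sign.
Qed.

Lemma sgnM P Q A : sgn P A * sgn Q A = sgn (fun a : 'I_n => P a (+) Q a) A.
Proof.
by rewrite /sgn -big_split; apply: eq_bigr => a _ /=; rewrite signr_addb.
Qed.

Definition fock := {ffun {set 'I_n} -> int}.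
Implicit Types v w : fock.

Definition vacuum : fock := [ffun A => (A == set0)%:R].

Definition flip P k w : fock := [ffun A => sgn P A * w (toggle k A)].

(* Left and right multiplication by the k-th generator of the Clifford        *)
(* algebra with basis {set 'I_n}; [twist k] is [lmul k] composed with the     *)
(* parity automorphism.                                                       *)
Definition lmul k := flip (fun a : 'I_n => (a < k)%N) k.
Definition rmul k := flip (fun a : 'I_n => (k < a)%N) k.
Definition twist k := flip (fun a : 'I_n => (k <= a)%N) k.

Lemma flip_flip P Q j k w A :
  flip P j (flip Q k w) A =
  (-1) ^+ Q j * (sgn P A * sgn Q A) * w (toggle j (toggle k A)).
Proof. by rewrite !ffunE sgn_toggle toggleC; ring. Qed.

Lemma flipB P k v w : flip P k (v - w) = flip P k v - flip P k w.
Proof. by apply/ffunP=> A; rewrite !ffunE mulrBr. Qed.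

Lemma lmulB k v w : lmul k (v - w) = lmul k v - lmul k w.
Proof. exact: flipB. Qed.

Lemma twistB k v w : twist k (v - w) = twist k v - twist k w.
Proof. exact: flipB. Qed.

Lemma lmul_sqr k w : lmul k (lmul k w) = w.
Proof.
by apply/ffunP=> A; rewrite flip_flip sgn_sqr toggleK /= ltnn !mul1r.
Qed.

Lemma lmul_anti i j w : i != j -> lmul i (lmul j w) = - lmul j (lmul i w).
Proof.
rewrite -val_eqE => /= ij; apply/ffunP=> A.
rewrite [RHS]ffunE !flip_flip (toggleC i) [sgn _ A * _]mulrC /=.
by case: ltngtP ij => // _ _; rewrite /= ?expr0 ?expr1; ring.
Qed.

Lemma lmul_rmul i j w : lmul i (rmul j w) = rmul j (lmul i w).
Proof.
apply/ffunP=> A; rewrite !flip_flip /= (toggleC i).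
by rewrite [sgn _ A * _]mulrC.
Qed.

Lemma sgn_geq k A :
  sgn (fun a : 'I_n => (k <= a)%N) A =
  sgn predT A * sgn (fun a : 'I_n => (a < k)%N) A.
Proof. by rewrite sgnM; apply: eq_bigr => a _ /=; rewrite ltnNge negbK. Qed.

Lemma lmul_twistC i k w : i != k -> lmul i (twist k w) = twist k (lmul i w).
Proof.
rewrite -val_eqE => /= ik; apply/ffunP=> A.
rewrite !flip_flip (toggleC i) [sgn _ A * _]mulrC /=.
by case: ltngtP ik.
Qed.

(** Both sides are minus the parity automorphism, whatever the generator. *)
Lemma lmul_twist_same i k w : lmul i (twist i w) = lmul k (twist k w).
Proof.
apply/ffunP=> A; rewrite !flip_flip !toggleK /= !leqnn !sgn_geq.
have sE l : sgn (fun a : 'I_n => (a < l)%N) A *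
    (sgn predT A * sgn (fun a : 'I_n => (a < l)%N) A) = sgn predT A.
  by rewrite mulrCA sgn_sqr mulr1.
by rewrite !sE.
Qed.

Lemma twist_lmul_same k w : twist k (lmul k w) = - lmul k (twist k w).
Proof.
apply/ffunP=> A; rewrite [RHS]ffunE !flip_flip /= ltnn leqnn expr0 expr1.
by ring.
Qed.

Lemma lmul_twist_swap i j w :
  i != j -> lmul i (twist j w) = - lmul j (twist i w).
Proof.
rewrite -val_eqE => /= ij; apply/ffunP=> A.
rewrite [RHS]ffunE !flip_flip (toggleC i) !sgn_geq /=.
by case: ltngtP ij => // _ _; rewrite /= ?expr0 ?expr1; ring.
Qed.

(** Trades left multiplication for right multiplication, which commutes with every [refl] and so
    passes through words unchanged. *)
Lemma vacuum_rmul k : twist k vacuum = - rmul k vacuum.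
Proof.
apply/ffunP=> A; rewrite !ffunE.
have [tA|_] := eqVneq (toggle k A) set0; last by rewrite !mulr0 oppr0.
have -> : A = [set k].
  by rewrite -(toggleK k A) tA; apply/setP=> a; rewrite !inE.
by rewrite /sgn !big_set1 /= leqnn ltnn.
Qed.

(* e_i - e_j is, up to the factor [sqrt 2], a lift of the transposition (i j) *)
(* to the spin group.                                                         *)
Definition refl (p : 'I_n * 'I_n) w : fock := lmul p.1 w - lmul p.2 w.

Lemma refl_sqr i j w : i != j -> refl (i, j) (refl (i, j) w) = w *+ 2.
Proof.
move=> ij; rewrite /refl /= !lmulB !lmul_sqr (lmul_anti w ij).
by rewrite opprK opprB addrACA subrr addr0 mulr2n.
Qed.

Lemma reflN i j w : refl (j, i) w = - refl (i, j) w.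
Proof. by rewrite /refl opprB. Qed.

Lemma refl_disjoint i j k l w : [&& i != k, i != l, j != k & j != l] ->
  refl (i, j) (refl (k, l) w) = - refl (k, l) (refl (i, j) w).
Proof.
case/and4P=> ik il jk jl; rewrite /refl /= !lmulB.
rewrite !(lmul_anti _ ik, lmul_anti _ il, lmul_anti _ jk, lmul_anti _ jl).
by apply/ffunP=> A; rewrite !ffunE; ring.
Qed.

Lemma refl_cycle i j k w : [&& i != j, j != k & k != i] ->
  refl (i, j) (refl (j, k) w) = refl (j, k) (refl (k, i) w).
Proof.
case/and3P=> ij jk ki; rewrite /refl /= !lmulB !lmul_sqr.
rewrite (lmul_anti _ ij) -(lmul_anti _ ki).
by apply/ffunP=> A; rewrite !ffunE; ring.
Qed.

(** Conjugation by e_i - e_j is minus the reflection exchanging e_i and e_j; the parity built into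
    [twist] absorbs the minus sign. *)
Lemma refl_twist p k w :
  p.1 != p.2 -> refl p (twist k w) = twist (tperm p.1 p.2 k) (refl p w).
Proof.
case: p => i j /= ij; rewrite /refl /= twistB.
case: tpermP => [->|->|/eqP ki /eqP kj].
- rewrite -(lmul_twistC _ ij) twist_lmul_same (lmul_twist_same i j).
  by rewrite (lmul_twist_swap _ ij); apply/ffunP=> A; rewrite !ffunE; ring.
- rewrite -(@lmul_twistC j i) 1?eq_sym // twist_lmul_same.
  rewrite (lmul_twist_same i j) (lmul_twist_swap _ ij).
  by apply/ffunP=> A; rewrite !ffunE; ring.
- by rewrite !lmul_twistC // eq_sym.
Qed.

Lemma refl_rmul p k w : refl p (rmul k w) = rmul k (refl p w).
Proof. by rewrite /refl !lmul_rmul /rmul flipB. Qed.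

(** * Words of transpositions and the signs of their lifts *)

Definition word_act (q : seq ('I_n * 'I_n)) w := foldr refl w q.

Definition word_perm (q : seq ('I_n * 'I_n)) : {perm 'I_n} :=
  (\prod_(p <- q) tperm p.1 p.2)%g.

Lemma word_perm_rev q : word_perm (rev q) = (word_perm q)^-1%g.
Proof.
elim: q => [|p q IH]; first by rewrite /word_perm big_nil invg1.
rewrite rev_cons /word_perm -cats1 big_cat /= big_seq1 -/(word_perm _) IH.
by rewrite big_cons invMg tpermV.
Qed.

Lemma word_act_cat q1 q2 w :
  word_act (q1 ++ q2) w = word_act q1 (word_act q2 w).
Proof. exact: foldr_cat. Qed.

Lemma reflB p v w : refl p (v - w) = refl p v - refl p w.
Proof. by rewrite /refl !lmulB; apply/ffunP=> A; rewrite !ffunE; ring. Qed.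

HB.instance Definition _ p :=
  GRing.isZmodMorphism.Build fock fock (refl p) (reflB p).

Lemma word_actB q v w : word_act q (v - w) = word_act q v - word_act q w.
Proof. by elim: q => //= p q ->; rewrite reflB. Qed.

HB.instance Definition _ q :=
  GRing.isZmodMorphism.Build fock fock (word_act q) (word_actB q).

Lemma word_act_twist q k w : all (@dpair _) q ->
  word_act q (twist k w) = twist ((word_perm q)^-1%g k) (word_act q w).
Proof.
elim: q => [_|p q IH /= /andP[dp dq]].
  by rewrite /word_perm big_nil invg1 perm1.
by rewrite IH // refl_twist // /word_perm big_cons invMg permM tpermV.
Qed.

Lemma word_act_rmul q k w : word_act q (rmul k w) = rmul k (word_act q w).
Proof. by elim: q => //= p q ->; rewrite refl_rmul. Qed.

Lemma word_act_rev q w : all (@dpair _) q ->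
  word_act q (word_act (rev q) w) = w *+ 2 ^ size q.
Proof.
elim: q w => [|[i j] q IH] w //= /andP[dp dq].
rewrite rev_cons -cats1 word_act_cat /= IH // raddfMn /=.
by rewrite refl_sqr // -mulrnA expnS.
Qed.

Definition vacuum_coef q : int := word_act q vacuum set0.

(* The action on the vacuum of a lift of the identity permutation is fixed by *)
(* all conjugations, hence lies in the center of the Clifford algebra.        *)
Lemma word_act_vacuum q : all (@dpair _) q -> word_perm q = 1%g ->
  word_act q vacuum = vacuum *~ vacuum_coef q.
Proof.
move=> dq q1; set w := word_act q vacuum.
have tw k : twist k w = - rmul k w.
  have: word_act q (twist k vacuum) = twist k w.
    by rewrite word_act_twist // q1 invg1 perm1.
  by rewrite vacuum_rmul raddfN /= word_act_rmul.
apply/ffunP=> A; rewrite ffunMzE ffunE.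
have [->|/set0Pn[k kA]] := eqVneq A set0; first by rewrite intz.
(* Compare coefficients at A minus k. Since k is absent there, [k <= a] and [k < a] give the same
   sign, and the relation becomes w A = - w A. *)
move/ffunP/(_ (toggle k A)): (tw k); rewrite !ffunE toggleK.
rewrite (_ : sgn _ _ = sgn (fun a : 'I_n => (k < a)%N) (toggle k A)).
  move/eqP; rewrite -addr_eq0 -mulr2n mulrn_eq0 mulf_eq0 mul0rz /=.
  case/orP=> [/eqP s0|/eqP //].
  by have := sgn_sqr (fun a : 'I_n => (k < a)%N) (toggle k A); rewrite s0.
apply: eq_bigr => a; rewrite inE => ta; rewrite leq_eqVlt orb_idl // => /eqP ka.
by move: ta; rewrite -(val_inj ka) kA eqxx.
Qed.

Lemma vacuum_coef_cat q1 q2 : all (@dpair _) q2 -> word_perm q2 = 1%g ->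
  vacuum_coef (q1 ++ q2) = vacuum_coef q1 * vacuum_coef q2.
Proof.
move=> d2 p2; rewrite [LHS]/vacuum_coef word_act_cat word_act_vacuum //.
by rewrite raddfMz /= ffunMzE mulrzz.
Qed.

Lemma vacuum_coef_insert q1 q q2 : all (@dpair _) q ->
  vacuum_coef (q1 ++ q ++ rev q ++ q2) = vacuum_coef (q1 ++ q2) * 2 ^+ size q.
Proof.
move=> dq; rewrite /vacuum_coef !word_act_cat word_act_rev // raddfMn ffunMnE.
by rewrite -[LHS]mulr_natr natrX.
Qed.

Definition perm_word (x : {perm 'I_n}) := sval (prod_tpermP x).

Lemma perm_wordK x : word_perm (perm_word x) = x.
Proof. by rewrite /perm_word; case: prod_tpermP => q /= -> _. Qed.

Lemma perm_word_dpair x : all (@dpair _) (perm_word x).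
Proof. by rewrite /perm_word; case: prod_tpermP. Qed.

(* The lift of x to the spin group given by [perm_word x], multiplied on the  *)
(* left by that of (b t), is this multiple of the lift of [tperm b t * x].    *)
Definition spin_sign (x : {perm 'I_n}) (b t : 'I_n) : int :=
  Num.sg
    (vacuum_coef (rev (perm_word (tperm b t * x)%g) ++ (b, t) :: perm_word x)).

Lemma word_perm_cons p q :
  word_perm (p :: q) = (tperm p.1 p.2 * word_perm q)%g.
Proof. by rewrite /word_perm big_cons. Qed.

Lemma word_perm_cat q1 q2 :
  word_perm (q1 ++ q2) = (word_perm q1 * word_perm q2)%g.
Proof. by rewrite /word_perm big_cat. Qed.

(** The chosen lift of the intermediate generator meets its own reverse and cancels, up to a
    positive power of 2 that [Num.sg] ignores. *)
Lemma spin_signM x b t c d : b != t -> c != d ->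
  spin_sign x b t * spin_sign (tperm b t * x)%g c d =
  Num.sg (vacuum_coef (rev (perm_word (tperm c d * (tperm b t * x))%g)
               ++ (c, d) :: (b, t) :: perm_word x)).
Proof.
move=> bt cd; rewrite mulrC -sgrM -vacuum_coef_cat; last 2 first.
- by rewrite all_cat all_rev /= !perm_word_dpair /dpair /= bt.
- by rewrite word_perm_cat word_perm_cons word_perm_rev !perm_wordK mulVg.
rewrite -catA cat_cons -cat_rcons vacuum_coef_insert ?perm_word_dpair // sgrM.
by rewrite cat_rcons [X in _ * X]gtr0_sg ?exprn_gt0 // mulr1.
Qed.

Lemma spin_signN x b t : spin_sign x t b = - spin_sign x b t.
Proof.
rewrite /spin_sign tpermC -sgrN; congr Num.sg.
by rewrite /vacuum_coef !word_act_cat /= reflN raddfN ffunE.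
Qed.

Lemma spin_sign_id x b t : b != t ->
  spin_sign x b t * spin_sign (tperm b t * x)%g b t = 1.
Proof.
move=> bt; rewrite spin_signM // tpermKg.
rewrite /vacuum_coef !word_act_cat /= refl_sqr //.
have := @word_act_rev (rev (perm_word x)) vacuum; rewrite revK all_rev => E.
rewrite !raddfMn /= {}E ?perm_word_dpair // !ffunMnE ffunE eqxx.
by rewrite gtr0_sg // !pmulrn_rgt0 ?expn_gt0.
Qed.

Lemma spin_sign_pm1 x b t : b != t -> spin_sign x b t \in pm1.
Proof.
move=> bt; have: spin_sign x b t != 0.
  by apply: contra_eq_neq (spin_sign_id x bt) => ->; rewrite mul0r.
by rewrite /spin_sign; case: sgrP => // _ _; rewrite !inE ?eqxx ?orbT.
Qed.

Lemma spin_sign_inv x b t : b != t ->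
  spin_sign x b t * spin_sign (tperm b t * x)%g t b = -1.
Proof. by move=> bt; rewrite (spin_signN _ b) mulrN spin_sign_id. Qed.

Lemma spin_sign_disjoint x b t c d : b != t -> c != d ->
  [&& b != c, b != d, t != c & t != d] ->
  spin_sign x b t * spin_sign (tperm b t * x)%g c d =
  - (spin_sign x c d * spin_sign (tperm c d * x)%g b t).
Proof.
move=> bt cd disj; rewrite !spin_signM // !mulgA.
have -> : (tperm c d * tperm b t = tperm b t * tperm c d)%g.
  case/and4P: disj => bc bd tc td; by rewrite conjgC tpermJ !tpermD.
rewrite -sgrN /vacuum_coef !word_act_cat /=.
rewrite [refl (b, t) (refl _ _)]refl_disjoint //.
by rewrite raddfN ffunE opprK.
Qed.

Lemma spin_sign_cycle x i j k : [&& i != j, j != k & k != i] ->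
  spin_sign x j k * spin_sign (tperm j k * x)%g i j =
  spin_sign x k i * spin_sign (tperm k i * x)%g j k.
Proof.
move=> ijk; have /and3P[ij jk ki] := ijk.
rewrite !spin_signM // !mulgA.
have -> : (tperm i j * tperm j k = tperm j k * tperm k i)%g.
  by rewrite conjgC tpermJ tpermL (tpermC k i) tpermD // eq_sym.
by rewrite /vacuum_coef !word_act_cat /= refl_cycle.
Qed.

End Clifford.

(** * Arcs and empty rectangles *)

Section Arcs.
Variable n : nat.
Implicit Types a b c d i : 'I_n.

Lemma cdistE a b : cdist a b = (if a <= b then b - a else b + n - a)%N.
Proof.
have an := ltn_ord a; have bn := ltn_ord b; rewrite /cdist.
case: leqP => ab; last by rewrite modn_small; lia.
have -> : (b + (n - a) = n + (b - a))%N by lia.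
by rewrite modnDl modn_small; lia.
Qed.

Lemma in_arcE a b i :
  in_arc a b i = ((a <= i) && (i < b) || (b < a) && ((a <= i) || (i < b)))%N.
Proof.
have := ltn_ord a; have := ltn_ord b; have := ltn_ord i.
by rewrite /in_arc !cdistE; case: (leqP a i); case: (leqP a b); lia.
Qed.

Lemma in_open_arcE a b i :
  in_open_arc a b i = ((a < i) && (i < b) || (b < a) && ((a < i) || (i < b)))%N.
Proof.
have := ltn_ord a; have := ltn_ord b; have := ltn_ord i.
by rewrite /in_open_arc !cdistE; case: (leqP a i); case: (leqP a b); lia.
Qed.

Lemma in_arc_start a b : a != b -> in_arc a b a.
Proof. by rewrite -val_eqE in_arcE /=; lia. Qed.

Lemma in_arc_end a b : in_arc a b b = false.
Proof. by rewrite in_arcE /=; lia. Qed.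

Lemma in_open_arc_rot a b c : in_open_arc a b c = in_open_arc c a b.
Proof. by rewrite !in_open_arcE; lia. Qed.

Lemma in_open_arc_sym a b c : a != b -> b != c -> c != a ->
  in_open_arc b a c = ~~ in_open_arc a b c.
Proof. by rewrite -!val_eqE !in_open_arcE /=; lia. Qed.

Lemma in_arc_split a b c i :
  in_open_arc a c b -> (in_arc a c i = in_arc a b i + in_arc b c i :> nat)%N.
Proof. by rewrite !in_arcE !in_open_arcE; lia. Qed.

Lemma arc_inj a b c d :
  a != b -> c != d -> in_arc a b =1 in_arc c d -> a = c /\ b = d.
Proof.
move=> ab cd E; have := E a; have := E b; have := E c; have := E d.
move: ab cd; rewrite -!val_eqE !in_arcE /= => *.
by split; apply: val_inj => /=; lia.
Qed.
End Arcs.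

Section EmptyRects.
Variable n : nat.
Implicit Types (x y z : generator n) (r : empty_rect n) (b t c d i j k : 'I_n).

(* An empty rectangle is encoded by its source x and the rows b, t of its     *)
(* horizontal edges: it is [x b, x t] x [b, t], with target [tperm b t * x].  *)
Definition empty x b t : bool :=
  (b != t)
  && [forall j, ~~ (in_open_arc b t j && in_open_arc (x b) (x t) (x j))].

Lemma emptyP x b t j : empty x b t ->
  ~~ (in_open_arc b t j && in_open_arc (x b) (x t) (x j)).
Proof. by case/andP=> _ /forallP. Qed.

Definition low r := bottom (Defs.shape r).
Definition high r := top (Defs.shape r).

Definition box x b t i j := in_arc (x b) (x t) i && in_arc b t j.

Lemma mem_points x i j : ((i, j) \in points x) = (x j == i).
Proof.
apply/imsetP/eqP => [[j' _ [-> ->]] //|<-].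
by exists j.
Qed.

Lemma empty_rectP r : [/\ empty (source r) (low r) (high r),
  target r = (tperm (low r) (high r) * source r)%g &
  diag (Defs.shape r) =
    ((source r (low r), low r), (source r (high r), high r))].
Proof.
case: r => [[[x y] r]] /= hr; rewrite /source /target /low /high /Defs.shape /=.
move: (hr); rewrite !inE !mem_points => /andP[/and5P[two]].
have := valP r; rewrite /left /right /bottom /top /=.
case: r hr => [[[l b] [r t]]] /= d hr; rewrite /Defs.shape /= => /andP[lr bt].
move=> /eqP xb /eqP xt /eqP yb /eqP yt /eqP emp.
split; rewrite ?xb ?xt //.
  rewrite /empty bt; apply/forallP=> j; apply/negP=> h.
  by move/setP: emp => /(_ (x j, j)); rewrite !inE mem_points eqxx andbT andbC
    /left /right /bottom /top /= -xb -xt h.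
have E : [set j | x j != y j] = [set b; t].
  apply/esym/eqP; rewrite eqEcard (eqP two) cards2 bt leqnn andbT.
  apply/subsetP=> j; rewrite !inE => /orP[]/eqP->; first by rewrite xb yb.
  by rewrite xt yt eq_sym.
apply/permP=> j; rewrite permM; case: tpermP => [->|->|/eqP jb /eqP jt].
- by rewrite yb.
- by rewrite yt.
- by move/setP: E => /(_ j); rewrite !inE (negPf jb) (negPf jt) => /negbFE/eqP.
Qed.

Lemma empty_rect_neq r : low r != high r.
Proof. by case: (empty_rectP r) => /andP[]. Qed.

Lemma empty_rect_inj r1 r2 :
  source r1 = source r2 -> low r1 = low r2 -> high r1 = high r2 -> r1 = r2.
Proof.
move=> es el eh; apply: val_inj.
have vE r : val r = (source r, target r, Defs.shape r).
  by case: r => -[[? ?] ?] ?.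
have [_ et1 ed1] := empty_rectP r1; have [_ et2 ed2] := empty_rectP r2.
have: Defs.shape r1 = Defs.shape r2.
  by apply: val_inj; rewrite /= ed1 ed2 es el eh.
by rewrite !vE et1 et2 es el eh => ->.
Qed.

Lemma empty_rect_exists x b t : empty x b t ->
  exists r, [/\ source r = x, low r = b & high r = t].
Proof.
move=> /[dup] exbt /andP[bt _].
have d : (x b != x t) && (b != t) by rewrite (inj_eq perm_inj) bt.
have hr : @MkRect n ((x b, b), (x t, t)) d \in Rect0 x (tperm b t * x)%g.
  rewrite !inE !mem_points /left /right /bottom /top /= !permM tpermL tpermR.
  rewrite !eqxx !andbT /=; apply/andP; split.
    rewrite /agree_but_two (_ : [set _ | _] = [set b; t]) ?cards2 ?bt //.
    apply/setP=> j; rewrite !inE permM (inj_eq perm_inj).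
    case: tpermP => [->|->|/eqP/negPf-> /eqP/negPf->]; rewrite ?eqxx ?bt //.
      by rewrite eq_sym bt orbT.
  apply/eqP/setP=> -[i j]; rewrite !inE mem_points /=; apply/negbTE.
  by apply/negP=> /andP[h /eqP xj]; have := emptyP j exbt; rewrite xj andbC h.
by exists (EmptyRect hr).
Qed.

Lemma rect_chainE r i j :
  rect_chain (Defs.shape r) (i, j) = (box (source r) (low r) (high r) i j)%:R.
Proof.
rewrite ffunE /= /box -/(low r) -/(high r) /left /right.
by case: (empty_rectP r) => _ _ ->.
Qed.

Definition mult x b t c d i j : nat :=
  (box x b t i j + box (tperm b t * x)%g c d i j)%N.

Lemma starE r1 r2 i j : composable r1 r2 ->
  dom_chain (star r1 r2) (i, j) =
  (mult (source r1) (low r1) (high r1) (low r2) (high r2) i j)%:R.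
Proof.
move=> comp; rewrite ffunE !rect_chainE -natrD /mult -comp.
by case: (empty_rectP r1) => _ ->.
Qed.

End EmptyRects.

(** * The sign assignment defined by the spin group *)

Section SpinSignAssignment.
Variable n : nat.
Implicit Types (x y z : generator n) (r : empty_rect n).
Implicit Types (b t c d i j k u : 'I_n).

Lemma swapL x b t : (tperm b t * x)%g b = x t.
Proof. by rewrite permM tpermL. Qed.

Lemma swapR x b t : (tperm b t * x)%g t = x b.
Proof. by rewrite permM tpermR. Qed.

Lemma swapD x b t u : b != u -> t != u -> (tperm b t * x)%g u = x u.
Proof. by move=> bu tu; rewrite permM tpermD. Qed.

(** The arc from b to t is neither empty nor the whole circle, so its indicator is not constant;
    hence [e] holds and the second arc is the complement of the first. *)
Lemma arcs_constant b t c d (e : bool) : b != t -> c != d ->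
  (forall j, in_arc b t j + (e && in_arc c d j) =
             in_arc b t t + (e && in_arc c d t))%N ->
  c = t /\ d = b.
Proof.
rewrite -!val_eqE /= => bt cd const.
have := const b; have := const c; have := const d; have := const t.
by rewrite !in_arcE => *; split; apply: val_inj => /=; lia.
Qed.

Lemma mult_vertical x b t c d (f : 'I_n -> nat) : b != t -> c != d ->
  (forall i j, mult x b t c d i j = f i) -> c = t /\ d = b.
Proof.
move=> bt cd const; apply: (@arcs_constant b t c d
  (in_arc ((tperm b t * x)%g c) ((tperm b t * x)%g d) (x b))) => // j.
have xbt : in_arc (x b) (x t) (x b) by rewrite in_arc_start ?(inj_eq perm_inj).
by move: (const (x b) j) (const (x b) t); rewrite /mult /box xbt /= => -> ->.
Qed.

Lemma mult_horizontal x b t c d (f : 'I_n -> nat) : b != t -> c != d ->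
  (forall i j, mult x b t c d i j = f j) -> c = b /\ d = t.
Proof.
move=> bt cd const; pose y := (tperm b t * x)%g.
have [||i|] := @arcs_constant (x b) (x t) (y c) (y d) (in_arc c d b).
- by rewrite (inj_eq perm_inj).
- by rewrite (inj_eq perm_inj).
- move: (const i b) (const (x t) b); rewrite /mult /box in_arc_start //.
  by rewrite !andbT ![in_arc c d b && _]andbC -/y => -> ->.
rewrite -(swapL x b t) -{1}(swapR x b t) -/y.
by move=> /perm_inj-> /perm_inj->.
Qed.

(** * Relative positions of two composable rectangles *)

Inductive swap_spec b t : 'I_n -> 'I_n -> Prop :=
| SwapSame : swap_spec b t b t
| SwapOpp : swap_spec b t t b
| SwapLow u of u != b & u != t : swap_spec b t b u
| SwapHigh u of u != b & u != t : swap_spec b t u t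
| SwapUp u of u != b & u != t : swap_spec b t t u
| SwapDown u of u != b & u != t : swap_spec b t u b
| SwapDisjoint c d of [&& b != c, b != d, t != c & t != d] : swap_spec b t c d.

Lemma swapP b t c d : b != t -> c != d -> swap_spec b t c d.
Proof.
move=> bt cd.
have [cb|cb] := eqVneq c b; have [ct|ct] := eqVneq c t;
have [db|db] := eqVneq d b; have [dt|dt] := eqVneq d t; subst;
  rewrite ?eqxx // in bt cd *; try by constructor.
by constructor; rewrite !(eq_sym b, eq_sym t) cb db ct dt.
Qed.

(** The sign of the 3-cycle [tperm i j * tperm j k], read along the path through [tperm j k * x]. By
    [hexsign_rot] it depends only on the cyclic order of i, j, k. *)
Definition hexsign x i j k : int :=
  spin_sign x j k * spin_sign (tperm j k * x)%g i j.

Lemma hexsign_rot x i j k : [&& i != j, j != k & k != i] ->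
  hexsign x i j k = hexsign x j k i.
Proof. exact: spin_sign_cycle. Qed.

(* Z l expresses that a 2-chain vanishes on the unit strip starting at v l    *)
(* (a column when v = x, a row when v = id).  The two rectangles of an        *)
(* L-shaped domain leave out one of the three strips at its corners, which    *)
(* recovers the order in which a given cycle (i, j, k) is traversed.          *)
Definition strip (e : bool) (v : 'I_n -> 'I_n) (Z : 'I_n -> Prop) i j k :=
  if e then [/\ in_open_arc (v i) (v k) (v j), Z k, ~ Z i & ~ Z j]
  else [/\ in_open_arc (v k) (v i) (v j), Z i, ~ Z j & ~ Z k].

Inductive rotation (T : Type) (i j k : T) : T -> T -> T -> Prop :=
| Rotation0 : rotation i j k i j k
| Rotation1 : rotation i j k j k i
| Rotation2 : rotation i j k k i j.

(** A rotation preserves the cyclic order of the three strips, which determines [e]; the only strip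
    on which the chain vanishes then fixes the labels. *)
Lemma strip_inj e e' v Z i j k i' j' k' :
  rotation i j k i' j' k' -> strip e v Z i j k -> strip e' v Z i' j' k' ->
  [/\ e = e', i = i', j = j' & k = k'].
Proof.
rewrite /strip => -[]; case: e; case: e' => -[a1 z1 z2 z3] [a1' z1' z2' z3'] //;
  by exfalso; move: a1 a1'; rewrite !in_open_arcE; lia.
Qed.

Lemma rotation_perm i j k i' j' k' :
  [&& i != j, j != k & k != i] -> [&& i' != j', j' != k' & k' != i'] ->
  (tperm i j * tperm j k = tperm i' j' * tperm j' k')%g ->
  rotation i j k i' j' k'.
Proof.
have cycE a b c : [&& a != b, b != c & c != a] ->
  [/\ (tperm a b * tperm b c)%g a = c, (tperm a b * tperm b c)%g c = b
    & (tperm a b * tperm b c)%g b = a].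
  case/and3P=> ab bc ca; have ac : a != c by rewrite eq_sym.
  have ba : b != a by rewrite eq_sym.
  by rewrite !permM (tpermD ac bc) !(tpermL, tpermR) tpermD.
move=> ijk ijk' E; have [ei ek ej] := cycE _ _ _ ijk.
have [] := cycE _ _ _ ijk'; rewrite -E => ei' ek' ej'.
have /and3P[_ _ ki'] := ijk'.
have [i'i|i'i] := eqVneq i' i.
  by move: ei' ek'; rewrite i'i ei => <-; rewrite ek => <-; constructor.
have [i'j|i'j] := eqVneq i' j.
  by move: ei' ek'; rewrite i'j ej => <-; rewrite ei => <-; constructor.
have [i'k|i'k] := eqVneq i' k.
  by move: ei' ek'; rewrite i'k ek => <-; rewrite ej => <-; constructor.
move: ki'; rewrite -ei' permM !(@tpermD _ _ _ i') ?eqxx // eq_sym //.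
Qed.

Definition misses_column x b t c d l := forall m, mult x b t c d (x l) m = 0%N.
Definition misses_row x b t c d l := forall m, mult x b t c d m l = 0%N.

(* The composite of empty rectangles with rows (b, t) and (c, d) sharing just *)
(* one of them: the two rectangles lie side by side if c = b or d = t, and on *)
(* top of each other if c = t or d = b.                                       *)
Definition side_by_side x b t c d := exists (e : bool) i j k,
  [/\ [&& i != j, j != k & k != i],
      (tperm c d * tperm b t = tperm i j * tperm j k)%g,
      spin_sign x b t * spin_sign (tperm b t * x)%g c d = - hexsign x i j k,
      (b, t) = (if e then (i, j) else (j, i))
    & strip e x (misses_column x b t c d) i j k].

Definition stacked x b t c d := exists (e : bool) i j k,
  [/\ [&& i != j, j != k & k != i],
      (tperm c d * tperm b t = tperm i j * tperm j k)%g,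
      spin_sign x b t * spin_sign (tperm b t * x)%g c d = hexsign x i j k,
      (b, t) = (if e then (j, k) else (k, j))
    & strip e id (misses_row x b t c d) i j k].

Lemma positive_box x b t c d l m :
  box x b t l m || box (tperm b t * x)%g c d l m -> mult x b t c d l m <> 0%N.
Proof. by rewrite /mult; do 2!case: (box _ _ _ _ _). Qed.

Lemma perm_neq_nat x b t : b != t -> ((x b : nat) != x t)%N.
Proof. by rewrite val_eqE (inj_eq perm_inj). Qed.

(** The two rectangles share their bottom row. The taller one is empty, which keeps the third point
    out of it and forces the cyclic order x b, x t, x u of the columns. The strip left out is the
    column starting at x u. *)
Lemma low_type x b t u : empty x b t -> empty (tperm b t * x)%g b u ->
  u != b -> u != t -> side_by_side x b t b u.
Proof.
move=> e1 e2 ub ut; have /andP[bt _] := e1.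
have [bu tu tb] : [/\ b != u, t != u & t != b] by split; rewrite eq_sym.
have ij : [&& b != t, t != u & u != b] by rewrite bt tu ub.
have yb := swapL x b t; have yt := swapR x b t; have yu := swapD x bu tu.
have o : in_open_arc (x b) (x u) (x t).
  move: (emptyP u e1) (emptyP t e2); rewrite yb yt yu.
  move: (perm_neq_nat x bt) (perm_neq_nat x bu) (perm_neq_nat x tu).
  by move: bt bu tu; rewrite -!val_eqE !in_open_arcE /=; lia.
exists true, b, t, u; split=> //.
- by rewrite conjgC tpermJ tpermL tpermD // eq_sym.
- by rewrite [X in _ * X]spin_signN mulrN -hexsign_rot // ub bt tu.
split=> // [m|/(_ b)|/(_ b)].
- rewrite /mult /box yb yu in_arc_end.
  rewrite (_ : in_arc (x b) (x t) (x u) = false) //.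
  by move: o; rewrite in_open_arcE in_arcE; lia.
- by apply: positive_box; rewrite /box !in_arc_start ?(inj_eq perm_inj).
apply: positive_box; rewrite /box yb yu !in_arc_start ?(inj_eq perm_inj) //.
by rewrite orbT.
Qed.

Lemma high_type x b t u : empty x b t -> empty (tperm b t * x)%g u t ->
  u != b -> u != t -> side_by_side x b t u t.
Proof.
move=> e1 e2 ub ut; have /andP[bt _] := e1.
have [bu tu tb] : [/\ b != u, t != u & t != b] by split; rewrite eq_sym.
have yb := swapL x b t; have yt := swapR x b t; have yu := swapD x bu tu.
have o : in_open_arc (x u) (x t) (x b).
  move: (emptyP u e1) (emptyP b e2); rewrite yb yt yu.
  move: (perm_neq_nat x bt) (perm_neq_nat x bu) (perm_neq_nat x tu).
  by move: bt bu tu; rewrite -!val_eqE !in_open_arcE /=; lia.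
exists false, t, b, u; split=> //.
- by rewrite tb bu.
- by rewrite (tpermC b t) conjgC tpermJ tpermL (tpermC b u) tpermD.
- by rewrite (spin_signN x t b) (tpermC b t) mulNr -hexsign_rot // ut tb bu.
split=> // [m|/(_ b)|/(_ u)].
- rewrite /mult /box yt yu in_arc_end.
  rewrite (_ : in_arc (x u) (x b) (x t) = false) //.
  by move: o; rewrite in_open_arcE in_arcE; lia.
- by apply: positive_box; rewrite /box !in_arc_start ?(inj_eq perm_inj).
apply: positive_box; rewrite /box yt yu !in_arc_start ?(inj_eq perm_inj) //.
by rewrite orbT.
Qed.

(** Here the two rectangles share their left column x b, and emptiness of the wider one forces the
    cyclic order b, t, u of the rows. The strip left out is the row starting at u. *)
Lemma up_type x b t u : empty x b t -> empty (tperm b t * x)%g t u ->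
  u != b -> u != t -> stacked x b t t u.
Proof.
move=> e1 e2 ub ut; have /andP[bt _] := e1.
have [bu tu tb] : [/\ b != u, t != u & t != b] by split; rewrite eq_sym.
have yb := swapL x b t; have yt := swapR x b t; have yu := swapD x bu tu.
have o : in_open_arc b u t.
  move: (emptyP u e1) (emptyP b e2); rewrite yb yt yu.
  move: (perm_neq_nat x bt) (perm_neq_nat x bu) (perm_neq_nat x tu).
  by move: bt bu tu; rewrite -!val_eqE !in_open_arcE /=; lia.
exists false, u, t, b; split=> //.
- by rewrite ut tb bu.
- by rewrite (tpermC b) (tpermC t u).
- rewrite /hexsign (spin_signN x t b) (spin_signN _ u t) (tpermC b t).
  by rewrite mulrNN.
split=> // [m|/(_ (x b))|/(_ (x b))].
- rewrite /mult /box in_arc_end (_ : in_arc b t u = false) ?andbF //.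
  by move: o; rewrite in_open_arcE in_arcE; lia.
- apply: positive_box; rewrite /box yt yu !in_arc_start ?(inj_eq perm_inj) //.
  by rewrite orbT.
by apply: positive_box; rewrite /box !in_arc_start ?(inj_eq perm_inj).
Qed.

Lemma down_type x b t u : empty x b t -> empty (tperm b t * x)%g u b ->
  u != b -> u != t -> stacked x b t u b.
Proof.
move=> e1 e2 ub ut; have /andP[bt _] := e1.
have [bu tu tb] : [/\ b != u, t != u & t != b] by split; rewrite eq_sym.
have yb := swapL x b t; have yt := swapR x b t; have yu := swapD x bu tu.
have o : in_open_arc u t b.
  move: (emptyP u e1) (emptyP t e2); rewrite yb yt yu.
  move: (perm_neq_nat x bt) (perm_neq_nat x bu) (perm_neq_nat x tu).
  by move: bt bu tu; rewrite -!val_eqE !in_open_arcE /=; lia.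
exists true, u, b, t; split=> //.
- by rewrite ub bt.
split=> // [m|/(_ (x u))|/(_ (x b))].
- rewrite /mult /box in_arc_end andbF (_ : in_arc u b t = false) ?andbF //.
  by move: o; rewrite in_open_arcE in_arcE; lia.
- apply: positive_box; rewrite /box yb yu !in_arc_start ?(inj_eq perm_inj) //.
  by rewrite orbT.
by apply: positive_box; rewrite /box !in_arc_start ?(inj_eq perm_inj).
Qed.

Inductive comp_spec x b t c d : Prop :=
| CompAnnulus of (tperm c d * tperm b t = 1)%g
    & (c, d) = (b, t) \/ (c, d) = (t, b)
| CompSide of side_by_side x b t c d
| CompStack of stacked x b t c d
| CompDisjoint of [&& b != c, b != d, t != c & t != d].

Lemma compP x b t c d : empty x b t -> empty (tperm b t * x)%g c d ->
  comp_spec x b t c d.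
Proof.
move=> e1; have /andP[bt _] := e1; case: (eqVneq c d) => [->|cd].
  by rewrite /empty eqxx.
case: (swapP bt cd) => [||u ub ut|u ub ut|u ub ut|u ub ut|c' d' disj] e2.
- by apply: CompAnnulus; [rewrite tperm2 | left].
- by apply: CompAnnulus; [rewrite tpermC tperm2 | right].
- by apply: CompSide; apply: low_type.
- by apply: CompSide; apply: high_type.
- by apply: CompStack; apply: up_type.
- by apply: CompStack; apply: down_type.
- exact: CompDisjoint.
Qed.

(** * Decompositions of a domain and the square relation *)

Lemma mult_disjoint x b t c d i j : [&& b != c, b != d, t != c & t != d] ->
  mult x b t c d i j = (box x b t i j + box x c d i j)%N.
Proof. by case/and4P=> *; rewrite /mult {2}/box !swapD. Qed.

Lemma box_start x b t : b != t -> box x b t (x b) b.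
Proof. by move=> bt; rewrite /box !in_arc_start ?(inj_eq perm_inj). Qed.

Lemma box_end x b t i : box x b t i t = false.
Proof. by rewrite /box in_arc_end andbF. Qed.

Lemma disjoint_tpermE b t c d : [&& b != c, b != d, t != c & t != d] ->
  let s := (tperm c d * tperm b t)%g in
  [/\ s b = t, s t = b, s c = d, s d = c
    & forall v, v \notin [:: b; t; c; d] -> s v = v].
Proof.
case/and4P=> bc bd tc td.
have [cb db ct dt] : [/\ c != b, d != b, c != t & d != t].
  by split; rewrite eq_sym.
split=> [||||v]; rewrite permM.
- by rewrite (tpermD cb db) tpermL.
- by rewrite (tpermD ct dt) tpermR.
- by rewrite tpermL (tpermD bd td).
- by rewrite tpermR (tpermD bc tc).
- by rewrite !inE !negb_or => /and4P[*]; rewrite !tpermD // eq_sym.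
Qed.

Lemma nat_of_bool_inj : injective nat_of_bool.
Proof. by do 2!case. Qed.

(** Comparing multiplicities at the four points of x in these rows puts b in [d, c), t in [c, d), c
    in [t, b) and d in [b, t). The first two order the rows cyclically as d, b, c, t, which
    contradicts the third. *)
Lemma box_flip2 x b t c d : b != t -> c != d ->
  [&& b != c, b != d, t != c & t != d] ->
  ~ (forall i j, box x b t i j + box x c d i j =
                 box x t b i j + box x d c i j)%N.
Proof.
move=> bt cd disj E.
have arc p q u v : p != q -> (box x p q (x p) p + box x u v (x p) p =
    box x q p (x p) p + box x v u (x p) p)%N -> in_arc v u p.
  move=> pq; rewrite box_start // box_end /box.
  by case: (in_arc v u p) => //; rewrite andbF.
have := arc _ _ _ _ bt (E (x b) b).
have [tb dc] : t != b /\ d != c by split; rewrite eq_sym.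
have := arc _ _ _ _ tb (esym (E (x t) t)).
have E' i j := etrans (addnC _ _) (etrans (E i j) (addnC _ _)).
have := arc _ _ _ _ cd (E' (x c) c); have := arc _ _ _ _ dc (esym (E' (x d) d)).
by move: bt cd disj; rewrite -!val_eqE !in_arcE /=; lia.
Qed.

(** The permutation determines the two unordered pairs of rows. What remains is to rule out
    exchanging bottom and top in one pair (a box never equals its flip) or in both ([box_flip2]). *)
Lemma disjoint_decomposition x b t c d b' t' c' d' :
  b != t -> c != d -> b' != t' -> c' != d' ->
  [&& b != c, b != d, t != c & t != d] ->
  [&& b' != c', b' != d', t' != c' & t' != d'] ->
  (tperm c d * tperm b t = tperm c' d' * tperm b' t')%g ->
  (forall i j, mult x b t c d i j = mult x b' t' c' d' i j) ->
  (b', t') = (b, t) \/ (b', t') = (c, d) /\ (c', d') = (b, t).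
Proof.
move=> bt cd bt' cd' disj disj' E Em.
have [sb st sc sd sv] := disjoint_tpermE disj.
have [sb' _ sc' _ _] := disjoint_tpermE disj'; rewrite -E in sb' sc'.
have {}Em i j : (box x b t i j + box x c d i j =
                 box x b' t' i j + box x c' d' i j)%N.
  by rewrite -!mult_disjoint.
have mem v w : v != w -> (tperm c d * tperm b t)%g v = w ->
    v \in [:: b; t; c; d].
  by move=> vw sw; apply: contraNT vw => /sv <-; rewrite sw.
have box_flip p q : p != q -> ~ (forall i j, box x p q i j = box x q p i j).
  by move=> pq /(_ (x p) p); rewrite box_start // box_end.
have := mem _ _ bt' sb'; have := mem _ _ cd' sc'; rewrite !inE.
move: disj' sb' sc' Em => /and4P[bc' bd' tc' td'] sb' sc' Em.
case/or4P=> /eqP ?; case/or4P=> /eqP ?; subst b' c';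
  rewrite ?sb ?st ?sc ?sd in sb' sc'; subst t' d'; auto;
  rewrite ?eqxx // in bc' bd' tc' td'; exfalso.
- apply: (box_flip _ _ cd) => i j; apply: nat_of_bool_inj.
  by apply: (@addnI (box x b t i j)); rewrite Em addnC.
- apply: (box_flip _ _ bt) => i j; apply: nat_of_bool_inj.
  by apply: (@addIn (box x c d i j)); rewrite Em addnC.
- by apply: (box_flip2 (x := x) bt cd disj) => i j; rewrite Em addnC.
- apply: (box_flip _ _ bt) => i j; apply: nat_of_bool_inj.
  exact: (@addIn (box x c d i j)).
- exact: (box_flip2 (x := x) bt cd disj).
Qed.

Lemma mult_horizontal_annulus x b t i j : b != t ->
  mult x b t b t i j = in_arc b t j.
Proof.
move=> bt; rewrite /mult /box swapL swapR !in_arcE.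
by move: (perm_neq_nat x bt); lia.
Qed.

Lemma mult_vertical_annulus x b t i j : b != t ->
  mult x b t t b i j = in_arc (x b) (x t) i.
Proof.
move=> bt; rewrite /mult /box swapL swapR; move: bt.
by rewrite -val_eqE !in_arcE /=; lia.
Qed.

Lemma annulus_inj x b t c d b' t' c' d' : b != t -> b' != t' ->
  (c, d) = (b, t) \/ (c, d) = (t, b) ->
  (c', d') = (b', t') \/ (c', d') = (t', b') ->
  (forall i j, mult x b t c d i j = mult x b' t' c' d' i j) ->
  (b, t) = (b', t').
Proof.
move=> bt bt' [][-> ->] [][-> ->] E.
- have [||j|-> -> //] := @arc_inj _ b t b' t' => //.
  by apply: nat_of_bool_inj; have := E j j; rewrite !mult_horizontal_annulus.
- have := E (x b') t; have := E (x t') b.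
  rewrite !mult_horizontal_annulus // !mult_vertical_annulus //.
  by rewrite !in_arc_end !in_arc_start // (inj_eq perm_inj).
- have := E (x b) t'; have := E (x t) b'.
  rewrite !mult_horizontal_annulus // !mult_vertical_annulus //.
  by rewrite !in_arc_end !in_arc_start // (inj_eq perm_inj).
have [||j|/perm_inj-> /perm_inj-> //] := @arc_inj _ (x b) (x t) (x b') (x t').
- by rewrite (inj_eq perm_inj).
- by rewrite (inj_eq perm_inj).
by apply: nat_of_bool_inj; have := E j j; rewrite !mult_vertical_annulus.
Qed.

Lemma strip_iff e v (Z Z' : 'I_n -> Prop) i j k :
  (forall l, Z l <-> Z' l) -> strip e v Z i j k -> strip e v Z' i j k.
Proof.
move=> ZZ'; have nZ l : ~ Z l -> ~ Z' l by move=> nz z'; apply/nz/ZZ'.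
by case: e => -[o z1 z2 z3]; split; by [|apply/ZZ'|apply: nZ].
Qed.

Lemma side_by_side_inj x b t c d b' t' c' d' :
  side_by_side x b t c d -> side_by_side x b' t' c' d' ->
  (tperm c d * tperm b t = tperm c' d' * tperm b' t')%g ->
  (forall i j, mult x b t c d i j = mult x b' t' c' d' i j) ->
  (b, t) = (b', t').
Proof.
move=> [e [i [j [k [ijk p _ -> st]]]]].
move=> [e' [i' [j' [k' [ijk' p' _ -> st']]]]] E Em.
have rot : rotation i j k i' j' k' by apply: rotation_perm; rewrite -?p -?p'.
have [|-> -> -> _ //] := strip_inj rot st (strip_iff _ st').
by move=> l; split=> h m; have := h m; rewrite Em.
Qed.

Lemma stacked_inj x b t c d b' t' c' d' :
  stacked x b t c d -> stacked x b' t' c' d' ->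
  (tperm c d * tperm b t = tperm c' d' * tperm b' t')%g ->
  (forall i j, mult x b t c d i j = mult x b' t' c' d' i j) ->
  (b, t) = (b', t').
Proof.
move=> [e [i [j [k [ijk p _ -> st]]]]].
move=> [e' [i' [j' [k' [ijk' p' _ -> st']]]]] E Em.
have rot : rotation i j k i' j' k' by apply: rotation_perm; rewrite -?p -?p'.
have [|-> _ -> -> //] := strip_inj rot st (strip_iff _ st').
by move=> l; split=> h m; have := h m; rewrite Em.
Qed.

(** Both products are, up to sign, [hexsign] of the same 3-cycle; the minus sign comes from the
    side-by-side case, where one transposition is written in the reverse order. *)
Lemma side_by_side_stacked x b t c d b' t' c' d' :
  side_by_side x b t c d -> stacked x b' t' c' d' ->
  (tperm c d * tperm b t = tperm c' d' * tperm b' t')%g ->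
  spin_sign x b t * spin_sign (tperm b t * x)%g c d =
  - (spin_sign x b' t' * spin_sign (tperm b' t' * x)%g c' d').
Proof.
move=> [e [i [j [k [ijk p -> _ _]]]]] [e' [i' [j' [k' [ijk' p' -> _ _]]]]] E.
have rot : rotation i j k i' j' k' by apply: rotation_perm; rewrite -?p -?p'.
congr (- _); case: rot ijk' => // ijk'; first exact: hexsign_rot.
by apply/esym; apply: hexsign_rot.
Qed.

(** Separates L shapes, which induce a 3-cycle, from annuli and disjoint pairs, which induce
    involutions. *)
Lemma cycle_not_invol i j k (s : {perm 'I_n}) :
  [&& i != j, j != k & k != i] -> s = (tperm i j * tperm j k)%g -> s (s i) != i.
Proof.
case/and3P=> ij jk ki ->; have ik : i != k by rewrite eq_sym.
by rewrite !permM tpermL tpermL (tpermD ik jk) tpermR eq_sym.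
Qed.

Lemma side_by_side_move x b t c d (s := (tperm c d * tperm b t)%g) :
  side_by_side x b t c d -> exists i, s (s i) != i.
Proof.
case=> [_ [i [j [k [ijk p _ _ _]]]]].
by exists i; apply: (cycle_not_invol ijk p).
Qed.

Lemma stacked_move x b t c d (s := (tperm c d * tperm b t)%g) :
  stacked x b t c d -> exists i, s (s i) != i.
Proof.
case=> [_ [i [j [k [ijk p _ _ _]]]]].
by exists i; apply: (cycle_not_invol ijk p).
Qed.

Lemma disjoint_invol b t c d i : [&& b != c, b != d, t != c & t != d] ->
  (tperm c d * tperm b t)%g ((tperm c d * tperm b t)%g i) = i.
Proof.
case/disjoint_tpermE=> sb st sc sd sv.
have [|/sv si] := boolP (i \in [:: b; t; c; d]); last by rewrite !si.
by rewrite !inE => /or4P[]/eqP->; rewrite ?sb ?st ?sc ?sd.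
Qed.

Lemma spin_sign_square x b t c d b' t' c' d' :
  empty x b t -> empty (tperm b t * x)%g c d ->
  empty x b' t' -> empty (tperm b' t' * x)%g c' d' ->
  (tperm c d * tperm b t = tperm c' d' * tperm b' t')%g ->
  (forall i j, mult x b t c d i j = mult x b' t' c' d' i j) ->
  (b, t) <> (b', t') ->
  spin_sign x b t * spin_sign (tperm b t * x)%g c d =
  - (spin_sign x b' t' * spin_sign (tperm b' t' * x)%g c' d').
Proof.
move=> e1 e2 e1' e2' E Em ne.
have [/andP[bt _] /andP[cd _] /andP[bt' _] /andP[cd' _]] := And4 e1 e2 e1' e2'.
case: (compP e1 e2) (compP e1' e2') => [s1 ann|sd|st|disj].
- case=> [_ ann'|sd'|st'|disj'].
  + by case: ne; apply: annulus_inj Em.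
  + by have [i] := side_by_side_move sd'; rewrite -E s1 !perm1 eqxx.
  + by have [i] := stacked_move st'; rewrite -E s1 !perm1 eqxx.
  + have [sb' _ _ _ _] := disjoint_tpermE disj'.
    by move: bt'; rewrite -sb' -E s1 perm1 eqxx.
- case=> [s1' ann'|sd'|st'|disj'].
  + by have [i] := side_by_side_move sd; rewrite E s1' !perm1 eqxx.
  + by case: ne; apply: side_by_side_inj Em.
  + exact: side_by_side_stacked.
  + by have [i] := side_by_side_move sd; rewrite E disjoint_invol ?eqxx.
- case=> [s1' ann'|sd'|st'|disj'].
  + by have [i] := stacked_move st; rewrite E s1' !perm1 eqxx.
  + by rewrite (side_by_side_stacked sd' st) ?opprK.
  + by case: ne; apply: stacked_inj Em.
  + by have [i] := stacked_move st; rewrite E disjoint_invol ?eqxx.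
case=> [s1' ann'|sd'|st'|disj'].
- have [sb _ _ _ _] := disjoint_tpermE disj.
  by move: bt; rewrite -sb E s1' perm1 eqxx.
- by have [i] := side_by_side_move sd'; rewrite -E disjoint_invol ?eqxx.
- by have [i] := stacked_move st'; rewrite -E disjoint_invol ?eqxx.
case: (disjoint_decomposition bt cd bt' cd' disj disj' E Em) => [bt_eq|].
  by case: ne.
by case=> -[-> ->] [-> ->]; apply: spin_sign_disjoint.
Qed.

Definition spin_assignment r := spin_sign (source r) (low r) (high r).

Lemma spin_assignmentP : sign_assignment spin_assignment.
Proof.
rewrite /spin_assignment; split=> [r|r1 r2 r1' r2'|r1 r2 comp|r1 r2 comp].
- exact/spin_sign_pm1/empty_rect_neq.
- move=> uniq_r comp comp' E.
  have sE : source r1 = source r1' := congr1 (@dom_source n) E.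
  have tE : target r2 = target r2' := congr1 (@dom_target n) E.
  have [e1 t1 _] := empty_rectP r1; have [e2 t2 _] := empty_rectP r2.
  have [e1' t1' _] := empty_rectP r1'; have [e2' t2' _] := empty_rectP r2'.
  have Em i j : mult (source r1) (low r1) (high r1) (low r2) (high r2) i j =
    mult (source r1) (low r1') (high r1') (low r2') (high r2') i j.
    apply/eqP; rewrite -(@eqr_nat int) {2}sE -!starE //.
    by rewrite E.
  move: tE; rewrite t2 t2' -comp -comp' t1 t1' -sE !mulgA => /mulIg tE.
  move: e2 e2'; rewrite -comp -comp' t1 t1' -sE in e1' * => e2 e2'.
  apply: spin_sign_square => // -[el eh].
  by move: uniq_r; rewrite /= !inE (empty_rect_inj sE el eh) eqxx !orbT.
- case=> a [b [ab E]]; have [_ t1 _] := empty_rectP r1.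
  have [cd1 cd2] : low r2 = high r1 /\ high r2 = low r1.
    apply: (@mult_vertical (source r1) _ _ _ _ (fun i => in_arc a b i));
      rewrite ?empty_rect_neq // => i j.
    by apply/eqP; rewrite -(@eqr_nat int) -starE // E ffunE.
  by rewrite -comp t1 cd1 cd2 spin_sign_inv ?empty_rect_neq.
case=> a [b [ab E]]; have [_ t1 _] := empty_rectP r1.
have [cd1 cd2] : low r2 = low r1 /\ high r2 = high r1.
  apply: (@mult_horizontal (source r1) _ _ _ _ (fun i => in_arc a b i));
    rewrite ?empty_rect_neq // => i j.
  by apply/eqP; rewrite -(@eqr_nat int) -starE // E ffunE.
by rewrite -comp t1 cd1 cd2 spin_sign_id ?empty_rect_neq.
Qed.

End SpinSignAssignment.

(** * Uniqueness *)

Lemma tperm_conj (T : finType) (i j k l : T) :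
  (tperm i j * (tperm k l * tperm i j) =
   tperm (tperm i j k) (tperm i j l))%g.
Proof. by rewrite -tpermJ conjgE tpermV. Qed.

Lemma tperm_braid (T : finType) (a b d : T) : a != b -> b != d -> a != d ->
  (tperm a b * tperm b d * tperm a b = tperm a d)%g /\
  (tperm b d * tperm a b * tperm b d = tperm a d)%g.
Proof.
move=> ab bd ad; rewrite -!mulgA !tperm_conj tpermL tpermR.
by split; rewrite tpermD // eq_sym.
Qed.

(** * Sign cochains on adjacent transpositions are coboundaries *)

Section Coxeter.
Variable n : nat.
Implicit Types (x : {perm 'I_n}) (a b c d : 'I_n).
Variable e : {perm 'I_n} -> 'I_n -> 'I_n -> int.

Definition consec a b := (b == a.+1 :> nat).

Hypothesis e_sqr : forall x a b, e x a b * e x a b = 1.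
Hypothesis e_sym : forall x a b, consec a b ->
  e (tperm a b * x)%g a b = e x a b.
Hypothesis e_comm : forall x a b c d, consec a b -> consec c d -> (b < c)%N ->
  e x a b * e (tperm a b * x)%g c d = e x c d * e (tperm c d * x)%g a b.
Hypothesis e_hex : forall x a b c, consec a b -> consec b c ->
  e x a b * e (tperm a b * x)%g b c * e (tperm b c * (tperm a b * x))%g a b =
  e x b c * e (tperm b c * x)%g a b * e (tperm a b * (tperm b c * x))%g b c.

Definition weight x := (\sum_(i < n) i * x i)%N.

(** The gain is exactly x a - x b. *)
Lemma weight_swap x a b : consec a b -> (x b < x a)%N ->
  (weight x < weight (tperm a b * x)%g)%N.
Proof.
move=> /eqP ab xba; have ba : b != a by rewrite -val_eqE /= ab; lia.
rewrite /weight (bigD1 a) // (bigD1 b) //= [X in (_ < X)%N](bigD1 a) //=.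
rewrite [X in (_ < _ + X)%N](bigD1 b) //= !permM tpermL tpermR !addnA.
rewrite [X in (_ < _ + X)%N](eq_bigr (fun i : 'I_n => i * x i)%N).
  by rewrite ltn_add2r ab; nia.
by move=> i /andP[ia ib]; rewrite permM tpermD // eq_sym.
Qed.

Definition descent x (p : 'I_n * 'I_n) := consec p.1 p.2 && (x p.2 < x p.1)%N.

(** A diamond argument along sorting. Swapping at a descent raises the weight, which is at most n^3,
    so f at x is prescribed by values at larger weight. Two descents at x prescribe the same value:
    by [e_comm] if they are far apart, by [e_hex] if they are adjacent. *)
Lemma coboundary_below k : exists f : {perm 'I_n} -> int,
  (forall x, f x * f x = 1) /\
  (forall x p, (n * n * n - weight x < k)%N -> descent x p ->
     f x = e x p.1 p.2 * f (tperm p.1 p.2 * x)%g).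
Proof.
elim: k => [|k [f [f_sqr fE]]].
  by exists (fun=> 1); split=> // x; rewrite mulr1.
(* Any descent may be picked, since confluence is proved below; at a new level, a permutation
   without descents gets 1. *)
pose f' x := if (n * n * n - weight x < k)%N then f x else
  if [pick p | descent x p] is Some p
  then e x p.1 p.2 * f (tperm p.1 p.2 * x)%g else 1.
have f'_sqr x : f' x * f' x = 1.
  rewrite /f'; case: ifP => // _; case: pickP => [p _|_]; last by rewrite mulr1.
  by rewrite mulrACA e_sqr f_sqr mulr1.
have w_le x : (weight x <= n * n * n)%N.
  rewrite -[X in (_ <= X * _ * _)%N](card_ord n) -mulnA -sum_nat_const.
  by apply: leq_sum => i _; apply: leq_mul; apply: ltnW.
have lt_k x p : (n * n * n - weight x < k.+1)%N -> descent x p ->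
    (n * n * n - weight (tperm p.1 p.2 * x)%g < k)%N.
  move=> xk /andP[ab /(weight_swap ab) h].
  by have := w_le (tperm p.1 p.2 * x)%g; lia.
exists f'; split=> // x p xk dp; rewrite [f' (_ * _)%g]/f' (lt_k _ _ xk dp).
rewrite /f'; case: ifP => [xk'|_]; first exact: fE.
case: pickP => [q dq|/(_ p)]; last by rewrite dp.
wlog pq : p q dp dq / (p.1 <= q.1)%N => [hw|].
  by case/orP: (leq_total p.1 q.1) => h; [|apply/esym]; apply: hw.
have [/andP[pn px] /andP[qn qx]] := (dp, dq).
move: p q dp dq pq pn px qn qx => [a b] [c d] dp dq /= ac ab xba cd xdc.
have [ca|ca] := eqVneq c a.
  have -> : d = b by apply: val_inj; rewrite /= (eqP ab) (eqP cd) ca.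
  by rewrite ca.
have ltac : (a < c)%N by rewrite ltn_neqAle ac eq_sym val_eqE ca.
have step y p : (n * n * n - weight y < k)%N -> descent y p ->
    [/\ f y = e y p.1 p.2 * f (tperm p.1 p.2 * y)%g &
        (n * n * n - weight (tperm p.1 p.2 * y)%g < k)%N].
  by move=> yk dy; split; [apply: fE | apply: lt_k dy; apply: ltnW].
have := lt_k _ _ xk dp; have := lt_k _ _ xk dq; rewrite /= => xck xak.
have [cb|cb] := eqVneq c b.
  (* Adjacent descents: the entries at a, b, d decrease, and both ways of sorting them end at the
     same permutation, along the two halves of a hexagon. *)
  move: ab cd (ab) (cd) => abn bdn /eqP ab /eqP cd; subst c.
  have [ab' bd' ad'] : [/\ a != b, b != d & a != d].
    by rewrite -!val_eqE /= cd ab; split; lia.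
  have [ba' db' da'] : [/\ b != a, d != b & d != a] by split; rewrite eq_sym.
  have [|-> y2k] := step _ (b, d) xak.
    by rewrite /descent /= bdn swapR (swapD x ad' bd') (ltn_trans xdc).
  have [|-> z2k] := step _ (a, b) xck.
    by rewrite /descent /= abn swapL (swapD x ba' da') (ltn_trans xdc).
  have [|-> _] := step _ (a, b) y2k.
    by rewrite /descent /= abn swapL (swapD _ ba' da') swapL (swapD x ad' bd').
  have [|-> _] := step _ (b, d) z2k.
    by rewrite /descent /= bdn swapR (swapD _ ad' bd') swapR (swapD x ba' da').
  have -> : (tperm a b * (tperm b d * (tperm a b * x)) =
             tperm b d * (tperm a b * (tperm b d * x)))%g.
    by rewrite !mulgA; have [-> ->] := tperm_braid ab' bd' ad'.
  by rewrite !mulrA e_hex.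
have ltbc : (b < c)%N.
  by rewrite (eqP ab) ltn_neqAle ltac -(eqP ab) eq_sym val_eqE cb.
have ne : [/\ a != c, a != d, b != c & b != d].
  by rewrite -!val_eqE /=; split; have := eqP cd; have := eqP ab => /=; lia.
case: ne => nac nad nbc nbd.
have [nca nda ncb ndb] : [/\ c != a, d != a, c != b & d != b].
  by split; rewrite eq_sym.
have [|-> _] := step _ (c, d) xak.
  by rewrite /descent /= cd !swapD.
have [|-> _] := step _ (a, b) xck.
  by rewrite /descent /= ab !swapD.
rewrite !mulrA (e_comm x ab cd ltbc); congr (_ * f _).
by rewrite !mulgA; congr (_ * x)%g; rewrite conjgC tpermJ !tpermD.
Qed.

Lemma coboundary : exists f : {perm 'I_n} -> int, (forall x, f x * f x = 1) /\
  (forall x a b, consec a b -> e x a b = f x * f (tperm a b * x)%g).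
Proof.
have [f [f_sqr fE]] := coboundary_below (n * n * n).+1.
exists f; split=> // x a b ab.
have [xba|xab] := ltnP (x b) (x a).
  have -> : f x = e x a b * f (tperm a b * x)%g.
    by apply: (fE _ (a, b)); rewrite ?ltnS ?leq_subr // /descent /= ab.
  by rewrite -mulrA f_sqr mulr1.
have {}xab : (x a < x b)%N.
  rewrite ltn_neqAle xab andbT val_eqE (inj_eq perm_inj) -val_eqE /= (eqP ab).
  by lia.
(* An ascent at x is a descent of the swapped permutation, with the same value of e by [e_sym]. *)
have -> : f (tperm a b * x)%g = e x a b * f x.
  rewrite (fE _ (a, b)) ?ltnS ?leq_subr //= ?tpermKg ?e_sym //.
  by rewrite /descent /= ab swapL swapR.
by rewrite mulrCA f_sqr mulr1.
Qed.
End Coxeter.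

(** * The product of two sign assignments, on rectangles of height one *)

Section Uniqueness.
Variable n : nat.
Implicit Types (x y z : generator n) (r : empty_rect n).
Implicit Types (b t c d i j k u : 'I_n).

Lemma empty_no_row x b t : b != t -> (forall j, ~~ in_open_arc b t j) ->
  empty x b t.
Proof.
by move=> bt h; rewrite /empty bt; apply/forallP=> j; rewrite (negPf (h j)).
Qed.

Lemma empty_no_column x b t : b != t ->
  (forall i, ~~ in_open_arc (x b) (x t) i) -> empty x b t.
Proof.
move=> bt h; rewrite /empty bt; apply/forallP=> j.
by rewrite (negPf (h _)) andbF.
Qed.

Lemma consec_neq a b : @consec n a b -> a != b.
Proof. by rewrite -val_eqE /= => /eqP->; rewrite ltn_eqF. Qed.

Lemma empty_consec x a b : consec a b -> empty x a b.
Proof.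
move=> ab; apply: empty_no_row => [|j]; first exact: consec_neq.
by rewrite in_open_arcE (eqP ab); lia.
Qed.

Lemma mult_L_shape x p q u i j :
  in_open_arc (x p) (x u) (x q) -> in_open_arc p q u ->
  mult x p q p u i j = mult x p u u q i j.
Proof.
move=> col row.
have [pq qu pu] : [/\ p != q, q != u & p != u].
  by move: row; rewrite -!val_eqE in_open_arcE /=; split; lia.
have qp : q != p by rewrite eq_sym.
have uq : u != q by rewrite eq_sym.
rewrite /mult /box swapL (swapD _ pu qu) swapR (swapD _ pq uq).
have := in_arc_split j row; have := in_arc_split i col.
by do 6!case: (in_arc _ _ _).
Qed.

Lemma mult_L_shape' x p q u i j :
  in_open_arc (x p) (x u) (x q) -> in_open_arc p q u ->
  mult x p q u q i j = mult x u q p u i j.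
Proof.
move=> col row.
have [pq qu pu] : [/\ p != q, q != u & p != u].
  by move: row; rewrite -!val_eqE in_open_arcE /=; split; lia.
have qp : q != p by rewrite eq_sym.
have up : u != p by rewrite eq_sym.
rewrite /mult /box swapR (swapD _ pu qu) swapL (swapD _ up qp).
have := in_arc_split j row.
have := in_arc_split i (etrans (in_open_arc_rot _ _ _) col).
by do 6!case: (in_arc _ _ _).
Qed.

Variable phi : empty_rect n -> int.

Hypothesis phi_sqr : forall r, phi r * phi r = 1.
Hypothesis phi_Sq : forall r1 r2 r1' r2', uniq [:: r1; r2; r1'; r2'] ->
  composable r1 r2 -> composable r1' r2' -> star r1 r2 = star r1' r2' ->
  phi r1 * phi r2 = phi r1' * phi r2'.
Hypothesis phi_V : forall r1 r2, composable r1 r2 ->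
  vertical_annulus (star r1 r2) -> phi r1 * phi r2 = 1.
Hypothesis phi_H : forall r1 r2, composable r1 r2 ->
  horizontal_annulus (star r1 r2) -> phi r1 * phi r2 = 1.

(** Extends phi to all triples, with value 1 when there is no empty rectangle, so that [row_phi_sqr]
    holds without an emptiness hypothesis. *)
Definition row_phi x b t : int :=
  if [pick r | [&& source r == x, low r == b & high r == t]] is Some r
  then phi r else 1.

Lemma row_phiE r : row_phi (source r) (low r) (high r) = phi r.
Proof.
rewrite /row_phi; case: pickP => [r' /and3P[/eqP s /eqP l /eqP h]|/(_ r)].
  by rewrite (empty_rect_inj s l h).
by rewrite !eqxx.
Qed.

Lemma row_phi_sqr x b t : row_phi x b t * row_phi x b t = 1.
Proof. by rewrite /row_phi; case: pickP => [r _|_]; rewrite ?mulr1. Qed.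

Lemma row_phi_vertical x b t : empty x b t -> empty (tperm b t * x)%g t b ->
  row_phi x b t = row_phi (tperm b t * x)%g t b.
Proof.
move=> /empty_rect_exists[r1 [<- <- <-]].
have [_ t1 _] := empty_rectP r1; rewrite -t1.
move=> /empty_rect_exists[r2 [s2 l2 h2]].
have -> : row_phi (target r1) (high r1) (low r1) = phi r2.
  by rewrite -s2 -l2 -h2 row_phiE.
rewrite row_phiE -[LHS]mulr1 -(phi_sqr r2) mulrA.
rewrite phi_V ?mul1r //; exists (source r1 (low r1)), (source r1 (high r1)).
split; first by rewrite (inj_eq perm_inj) empty_rect_neq.
apply/ffunP=> -[i j]; rewrite starE // ffunE l2 h2 mult_vertical_annulus //.
exact: empty_rect_neq.
Qed.

Lemma row_phi_horizontal x b t : empty x b t -> empty (tperm b t * x)%g b t ->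
  row_phi x b t = row_phi (tperm b t * x)%g b t.
Proof.
move=> /empty_rect_exists[r1 [<- <- <-]].
have [_ t1 _] := empty_rectP r1; rewrite -t1.
move=> /empty_rect_exists[r2 [s2 l2 h2]].
have -> : row_phi (target r1) (low r1) (high r1) = phi r2.
  by rewrite -s2 -l2 -h2 row_phiE.
rewrite row_phiE -[LHS]mulr1 -(phi_sqr r2) mulrA.
rewrite phi_H ?mul1r //; exists (low r1), (high r1).
split; first exact: empty_rect_neq.
apply/ffunP=> -[i j]; rewrite starE // ffunE l2 h2 mult_horizontal_annulus //.
exact: empty_rect_neq.
Qed.

Lemma row_phi_square x b t c d b' t' c' d' :
  empty x b t -> empty (tperm b t * x)%g c d ->
  empty x b' t' -> empty (tperm b' t' * x)%g c' d' ->
  (tperm c d * tperm b t = tperm c' d' * tperm b' t')%g ->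
  (forall i j, mult x b t c d i j = mult x b' t' c' d' i j) ->
  tperm b t != tperm b' t' ->
  row_phi x b t * row_phi (tperm b t * x)%g c d =
  row_phi x b' t' * row_phi (tperm b' t' * x)%g c' d'.
Proof.
move=> /empty_rect_exists[r1 [<- <- <-]]; have [e1 t1 _] := empty_rectP r1.
rewrite -t1 => /empty_rect_exists[r2 [s2 <- <-]].
move=> /empty_rect_exists[r1' [s1' <- <-]].
have [_ t1' _] := empty_rectP r1'; rewrite s1' in t1'; rewrite -t1'.
move=> /empty_rect_exists[r2' [s2' <- <-]] E Em ne.
have := row_phiE r1'; rewrite s1' => ->; rewrite -s2 -s2' !row_phiE.
(* Distinct intermediate generators separate r1 from r1'; every other pair already differs in its
   source. *)
have t_neq : target r1 != target r1'.
  by apply: contraNneq ne; rewrite t1 t1' => /mulIg->.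
have s_neq r : source r != target r.
  have [_ -> _] := empty_rectP r; apply/eqP=> /permP/(_ (low r)).
  by rewrite swapL => /perm_inj/eqP; rewrite (negPf (empty_rect_neq r)).
have src r r' : source r != source r' -> r != r' by apply: contraNneq => ->.
have [_ t2 _] := empty_rectP r2; have [_ t2' _] := empty_rectP r2'.
apply: phi_Sq => //.
  have n12 : r1 != r2 by apply: src; rewrite s2.
  have n11' : r1 != r1' by apply: contraNneq t_neq => ->.
  have n12' : r1 != r2' by apply: src; rewrite s2' -s1'.
  have n21' : r2 != r1' by apply: src; rewrite s2 s1' eq_sym.
  have n22' : r2 != r2' by apply: src; rewrite s2 s2'.
  have n1'2' : r1' != r2' by apply: src; rewrite s2'.
  rewrite !cons_uniq !in_cons !in_nil (negPf n12) (negPf n11') (negPf n12').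
  by rewrite (negPf n21') (negPf n22') (negPf n1'2').
have tE : target r2 = target r2' by rewrite t2 t2' s2 s2' t1 t1' !mulgA E.
have cE : dom_chain (star r1 r2) = dom_chain (star r1' r2').
  by apply/ffunP=> -[i j]; rewrite !starE // Em s1'.
by move: cE; rewrite /star /= s1' tE => ->.
Qed.

Lemma row_phi_comm x a b c d : consec a b -> consec c d -> (b < c)%N ->
  row_phi x a b * row_phi (tperm a b * x)%g c d =
  row_phi x c d * row_phi (tperm c d * x)%g a b.
Proof.
move=> ab cd bc.
have disj : [&& a != c, a != d, b != c & b != d].
  by rewrite -!val_eqE /=; have := eqP ab; have := eqP cd; lia.
have disj' : [&& c != a, c != b, d != a & d != b].
  by case/and4P: disj => *; rewrite !(eq_sym c) !(eq_sym d); apply/and4P.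
apply: row_phi_square; rewrite ?empty_consec //.
- by case/and4P: disj => *; rewrite [RHS]conjgC tpermJ !tpermD // eq_sym.
- by move=> i j; rewrite !mult_disjoint // addnC.
apply/eqP=> /permP/(_ a); rewrite tpermL.
case/and4P: disj' => ca _ da _; rewrite tpermD // => E.
by have := consec_neq ab; rewrite E eqxx.
Qed.

Lemma tperm_neq i j k l : i != j -> k != i -> l != i -> tperm i j != tperm k l.
Proof.
move=> ij ki li; apply/eqP=> /permP/(_ i); rewrite tpermL tpermD // => E.
by rewrite E eqxx in ij.
Qed.

Lemma row_phi_L x p q u : in_open_arc (x p) (x u) (x q) -> in_open_arc p q u ->
  empty x p q -> empty (tperm p q * x)%g p u ->
  empty x p u -> empty (tperm p u * x)%g u q ->
  row_phi x p q * row_phi (tperm p q * x)%g p u =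
  row_phi x p u * row_phi (tperm p u * x)%g u q.
Proof.
move=> col row e1 e2 e3 e4.
have [pq qu pu] : [/\ p != q, q != u & p != u].
  by move: row; rewrite -!val_eqE in_open_arcE /=; split; lia.
apply: row_phi_square => //; last 2 first.
- by move=> i j; apply: mult_L_shape.
- by rewrite (tpermC p q); apply: tperm_neq => //; rewrite eq_sym.
by rewrite [RHS]conjgC tpermJ tpermR tpermD // eq_sym.
Qed.

Lemma row_phi_L' x p q u : in_open_arc (x p) (x u) (x q) -> in_open_arc p q u ->
  empty x p q -> empty (tperm p q * x)%g u q ->
  empty x u q -> empty (tperm u q * x)%g p u ->
  row_phi x p q * row_phi (tperm p q * x)%g u q =
  row_phi x u q * row_phi (tperm u q * x)%g p u.
Proof.
move=> col row e1 e2 e3 e4.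
have [pq qu pu] : [/\ p != q, q != u & p != u].
  by move: row; rewrite -!val_eqE in_open_arcE /=; split; lia.
apply: row_phi_square => //; last 2 first.
- by move=> i j; apply: mult_L_shape'.
- by apply: tperm_neq => //; rewrite eq_sym.
by rewrite [RHS]conjgC tpermJ tpermL tpermD // eq_sym.
Qed.

Lemma row_phi_sym x a b : consec a b ->
  row_phi (tperm a b * x)%g a b = row_phi x a b.
Proof. by move=> ab; apply/esym/row_phi_horizontal; apply: empty_consec. Qed.

Lemma consec2 a b c : consec a b -> consec b c ->
  [/\ a != b, b != c, a != c & in_open_arc a c b].
Proof.
by rewrite /consec in_open_arcE -!val_eqE /= => /eqP-> /eqP->; split; lia.
Qed.

(** In this cyclic order the rectangle of height two from row a to row c is empty, and it starts the
    side-by-side decompositions of two L shapes. The remaining factors pair off, and both sides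
    equal its value. *)
Lemma row_phi_hex_col x a b c : consec a b -> consec b c ->
  in_open_arc (x a) (x b) (x c) ->
  row_phi x a b * row_phi (tperm a b * x)%g b c
    * row_phi (tperm b c * (tperm a b * x))%g a b =
  row_phi x b c * row_phi (tperm b c * x)%g a b
    * row_phi (tperm a b * (tperm b c * x))%g b c.
Proof.
move=> nab nbc col; have [ab bc ac row] := consec2 nab nbc.
have eac : empty x a c.
  rewrite /empty ac; apply/forallP=> j; apply/negP=> /andP[rj cj].
  have jb : j = b.
    apply: val_inj; move: rj; rewrite in_open_arcE /=.
    by rewrite (eqP nbc) (eqP nab); lia.
  by move: cj col; rewrite jb !in_open_arcE; lia.
have L := row_phi_L col row eac (empty_consec _ nab) (empty_consec _ nab)
  (empty_consec _ nbc).
have L' := row_phi_L' col row eac (empty_consec _ nbc) (empty_consec _ nbc)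
  (empty_consec _ nab).
rewrite -L -L' -!mulrA.
have -> : (tperm b c * (tperm a b * x) = tperm a b * (tperm a c * x))%g.
  have [<- _] := tperm_braid ab bc ac.
  by rewrite !mulgA tperm2 mul1g.
have -> : (tperm a b * (tperm b c * x) = tperm b c * (tperm a c * x))%g.
  have [_ <-] := tperm_braid ab bc ac.
  by rewrite !mulgA tperm2 mul1g.
by rewrite !row_phi_sym // !row_phi_sqr.
Qed.

Lemma row_phi_hex x a b c : consec a b -> consec b c ->
  row_phi x a b * row_phi (tperm a b * x)%g b c
    * row_phi (tperm b c * (tperm a b * x))%g a b =
  row_phi x b c * row_phi (tperm b c * x)%g a b
    * row_phi (tperm a b * (tperm b c * x))%g b c.
Proof.
move=> nab nbc; have [ab bc ac _] := consec2 nab nbc.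
have [|col] := boolP (in_open_arc (x a) (x b) (x c)).
  exact: row_phi_hex_col.
have [E1 E2] := tperm_braid ab bc ac.
(* In the other cyclic order, apply the previous case at the opposite vertex of the hexagon; the two
   paths are then traversed backwards. *)
have := @row_phi_hex_col (tperm a c * x)%g a b c nab nbc.
rewrite swapL swapR (@swapD _ x a c b) 1?[c == b]eq_sym //.
rewrite in_open_arc_rot in_open_arc_sym ?(inj_eq perm_inj) // 1?eq_sym //.
rewrite -in_open_arc_rot => /(_ col).
have Eab : (tperm a b * (tperm a c * x) = tperm b c * (tperm a b * x))%g.
  by rewrite -E1 !mulgA tperm2 mul1g.
have Ebc : (tperm b c * (tperm a c * x) = tperm a b * (tperm b c * x))%g.
  by rewrite -E2 !mulgA tperm2 mul1g.
rewrite -(row_phi_sym (tperm a c * x)%g nab).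
rewrite -(row_phi_sym (tperm a c * x)%g nbc).
rewrite Eab Ebc !tpermKg !row_phi_sym // => E.
have rev (u v w : int) : u * v * w = w * v * u by rewrite mulrC (mulrC u) mulrA.
by rewrite rev E rev.
Qed.

Lemma row_phi_potential : exists f : generator n -> int,
  (forall x, f x * f x = 1) /\
  (forall x a b, consec a b -> row_phi x a b = f x * f (tperm a b * x)%g).
Proof.
apply: coboundary => *; [exact: row_phi_sqr | exact: row_phi_sym |
  exact: row_phi_comm | exact: row_phi_hex].
Qed.

(** * From height one to all empty rectangles *)

Section Potential.
Variable f : generator n -> int.
Hypothesis f_sqr : forall x, f x * f x = 1.

Definition gauge x b t := f x * row_phi x b t * f (tperm b t * x)%g.

Hypothesis gauge_consec : forall x a b, consec a b -> gauge x a b = 1.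

Lemma gauge_L x p q u : in_open_arc (x p) (x u) (x q) -> in_open_arc p q u ->
  empty x p q -> empty (tperm p q * x)%g p u ->
  empty x p u -> empty (tperm p u * x)%g u q ->
  gauge x p q * gauge (tperm p q * x)%g p u =
  gauge x p u * gauge (tperm p u * x)%g u q.
Proof.
move=> col row e1 e2 e3 e4; have := row_phi_L col row e1 e2 e3 e4.
have gM y z (w g1 g2 : int) :
    f y * g1 * f z * (f z * g2 * w) = f y * (g1 * g2) * w.
  by rewrite -!mulrA (mulrA (f z)) f_sqr mul1r.
rewrite /gauge !gM => ->; congr (_ * f _).
have [pq qu pu] : [/\ p != q, q != u & p != u].
  by move: row; rewrite -!val_eqE in_open_arcE /=; split; lia.
rewrite !mulgA; congr (_ * x)%g.
by rewrite [RHS]conjgC tpermJ tpermR tpermD // eq_sym.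
Qed.

Lemma gauge_rising x b t : (b < t)%N -> empty x b t -> gauge x b t = 1.
Proof.
have [m] := ubnP (t - b); elim: m x b => // m IH x b le_m bt e.
have lt_b : (b.+1 < n)%N by apply: leq_trans (ltn_ord t).
have [u uE] : exists u : 'I_n, u = b.+1 :> nat by exists (Ordinal lt_b).
have bu : consec b u by apply/eqP.
have [tu|tu] := eqVneq u t; first by rewrite -tu; apply: gauge_consec.
have {}tu : (u < t)%N by rewrite ltn_neqAle val_eqE tu uE.
have row : in_open_arc b t u by rewrite in_open_arcE; lia.
have [ub ut] : u != b /\ t != u by rewrite -!val_eqE /=; split; lia.
have tb : t != b by rewrite -val_eqE /=; lia.
have col : in_open_arc (x b) (x u) (x t).
  have := emptyP u e; rewrite row /= in_open_arc_rot => h.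
  by rewrite in_open_arc_sym ?(inj_eq perm_inj) // 1?eq_sym.
have e4 : empty (tperm b u * x)%g u t.
  rewrite /empty eq_sym ut; apply/forallP=> j; apply/negP=> /andP[rj cj].
  have [bj uj] : b != j /\ u != j.
    by move: rj; rewrite -!val_eqE in_open_arcE /=; split; lia.
  rewrite swapR !swapD // 1?eq_sym // in cj.
  have := emptyP j e; rewrite cj andbT; move: rj; rewrite !in_open_arcE /=; lia.
(* The L shape is the rectangle followed by a bottom slice of height one; cut the other way, it is a
   slice of height one with a shorter rectangle above. *)
have := gauge_L col row e (empty_consec _ bu) (empty_consec _ bu) e4.
by rewrite !(gauge_consec _ bu) !mulr1 mul1r => ->; apply: IH => //; lia.
Qed.

Lemma ordSE i : ordS i = (if i.+1 == n then 0 else i.+1)%N :> nat.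
Proof.
rewrite /=; case: eqP => [->|/eqP ne]; first by rewrite modnn.
by rewrite modn_small // ltn_neqAle ne ltn_ord.
Qed.

Lemma empty_narrow x b t : b != t -> x t = ordS (x b) -> empty x b t.
Proof.
move=> bt xt; apply: empty_no_column => // i; rewrite xt in_open_arcE ordSE.
by have := ltn_ord i; have := ltn_ord (x b); case: ifP; lia.
Qed.

(** If the rectangle crosses the circle of ordinate 0, its complement in the vertical annulus of
    width one does not, and is empty as well. *)
Lemma gauge_narrow x b t : b != t -> x t = ordS (x b) -> gauge x b t = 1.
Proof.
move=> bt xt; have e := empty_narrow bt xt.
have [lt_bt|] := ltnP b t; first exact: gauge_rising.
rewrite leq_eqVlt val_eqE eq_sym (negPf bt) /= => lt_tb.
have e' : empty (tperm b t * x)%g t b.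
  by apply: empty_narrow; rewrite 1?eq_sym // swapL swapR.
rewrite /gauge row_phi_vertical // mulrC (mulrC (f x)) mulrA.
by have := gauge_rising lt_tb e'; rewrite /gauge (tpermC t b) tpermKg.
Qed.

Lemma gauge_all x b t : empty x b t -> gauge x b t = 1.
Proof.
have [m] := ubnP (cdist (x b) (x t)); elim: m x b => // m IH x b le_m e.
have /andP[bt _] := e.
(* The row of the point one column to the right of x b. Cutting along this column leaves rectangles
   of width one and a rectangle narrower by one. *)
pose u := (x^-1)%g (ordS (x b)); have xu : x u = ordS (x b) by rewrite permKV.
have [ut|ut] := eqVneq u t; first by apply: gauge_narrow; rewrite // -ut.
have xbt : (x b : nat) != x t by rewrite perm_neq_nat.
(* Equality would force n = 1, whereas x b and x t differ. *)
have bu : b != u.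
  apply/eqP=> bu; move: (ltn_ord (x b)) (ltn_ord (x t)) xbt.
  have := congr1 (@nat_of_ord n) xu; rewrite -bu ordSE.
  by case: ifP; lia.
have xut : (x u : nat) != x t by rewrite perm_neq_nat.
have xbu : (x b : nat) != x u by rewrite perm_neq_nat.
have xuE : x u = (if (x b).+1 == n then 0 else (x b).+1)%N :> nat.
  by rewrite xu ordSE.
have col : in_open_arc (x b) (x t) (x u).
  move: (ltn_ord (x b)) (ltn_ord (x t)) xuE xbt xut xbu.
  by rewrite in_open_arcE; case: ifP; lia.
have tu : t != u by rewrite eq_sym.
have row : in_open_arc b u t.
  have := emptyP u e; rewrite col andbT => h.
  by rewrite in_open_arc_rot in_open_arc_sym // 1?eq_sym // in_open_arc_rot.
have e2 : empty (tperm b u * x)%g b t.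
  rewrite /empty bt; apply/forallP=> j; apply/negP=> /andP[rj].
  have [bj uj] : b != j /\ u != j.
    by move: rj row; rewrite -!val_eqE !in_open_arcE /=; split; lia.
  rewrite swapL !swapD // 1?eq_sym // => cj.
  have := emptyP j e; rewrite rj /=; move: cj col; rewrite !in_open_arcE; lia.
have e1 := empty_narrow bu xu.
have xt' : (tperm b t * x)%g u = ordS ((tperm b t * x)%g t).
  by rewrite swapR swapD.
have e4 := empty_narrow tu xt'.
have := gauge_L col row e1 e2 e e4; rewrite (gauge_narrow bu xu) mul1r.
rewrite (gauge_narrow tu xt') mulr1 => <-; apply: IH => //.
rewrite swapL swapD // 1?eq_sym //.
move: (ltn_ord (x b)) (ltn_ord (x t)) xuE xbt xut xbu le_m.
rewrite !cdistE; case: (leqP (x u) (x t)); case: (leqP (x b) (x t));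
  by case: ifP; lia.
Qed.
End Potential.

Lemma phi_coboundary : exists f : generator n -> int,
  (forall x, f x * f x = 1) /\ forall r, phi r = f (source r) * f (target r).
Proof.
have [f [f_sqr fE]] := row_phi_potential; exists f; split=> // r.
have [e t _] := empty_rectP r.
have gc x a b : consec a b -> gauge f x a b = 1.
  by move=> ab; rewrite /gauge fE // mulrA f_sqr mul1r f_sqr.
have := gauge_all f_sqr gc e; rewrite /gauge row_phiE -t => E.
rewrite -[LHS]mul1r -(f_sqr (source r)) -[LHS]mulr1 -(f_sqr (target r)).
by rewrite -!mulrA; congr (_ * _); rewrite !mulrA E mul1r.
Qed.
End Uniqueness.

Theorem theorem4p2 (n : nat) (n_gt0 : (0 < n)%N) :
  (exists S : empty_rect n -> int, sign_assignment S) /\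
  (forall S1 S2 : empty_rect n -> int,
     sign_assignment S1 -> sign_assignment S2 ->
     exists f : generator n -> int,
       (forall x : generator n, f x \in pm1) /\
       (forall (x y : generator n) (r : rect n) (hr : r \in Rect0 x y),
          S1 (EmptyRect hr) = f x * f y * S2 (EmptyRect hr))).
Proof.
split=> [|S1 S2 A1 A2].
  by exists (@spin_assignment n); apply: spin_assignmentP.
have sqr S (A : sign_assignment S) (r : empty_rect n) : S r * S r = 1.
  by case/pred2P: (sign_pm1 A r) => ->; rewrite ?mulrNN mulr1.
have [||||f [f_sqr fE]] := @phi_coboundary n (fun r => S1 r * S2 r).
- by move=> r; rewrite mulrACA !sqr // mulr1.
- move=> r1 r2 r1' r2' u c c' E; rewrite mulrACA [RHS]mulrACA.
  by rewrite (sign_Sq A1 u c c' E) (sign_Sq A2 u c c' E) mulrNN.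
- move=> r1 r2 c v; rewrite mulrACA (sign_V A1 c v) (sign_V A2 c v).
  by rewrite mulrNN mulr1.
- by move=> r1 r2 c h; rewrite mulrACA (sign_H A1 c h) (sign_H A2 c h) mulr1.
exists f; split=> [x|x y r hr].
  by have /eqP := f_sqr x; rewrite -expr2 sqrf_eq1.
have := fE (EmptyRect hr); rewrite /source /target /= => <-.
by rewrite -mulrA sqr // mulr1.
Qed.
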